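(* Let $k$ be an algebraically closed field of characteristic zero, $F$ an algebraically closed extension of $k$ of finite transcendence degree $n\ge 1$, and $G=\mathrm{Aut}(F/k)$. Any finite-dimensional polarizable $G$-module is zero.
   Context: Topology on $G$: for a subfield $k\subseteq K\subseteq F$ put $U_K=\mathrm{Aut}(F/K)$; the subgroups $U_{k(x)}$, $x\in F$, generate the neighbourhoods of $1$ (equivalently, the $U_L$ with $L$ finitely generated over $k$ form a base of neighbourhoods of $1$). $G$-modules are $\mathbb{Q}$-vector spaces. A $G$-module $W$ is smooth if stabilizers of all vectors are open, and admissible if moreover $\dim_{\mathbb{Q}}W^U<\infty$ for every open subgroup $U$. $\mathbb{Q}(\chi)$ is the $\mathbb{Q}$-vector space generated by symbols $[U]$ for compact open subgroups $U\subset G$ modulo $[U]=[U:U'][U']$ for $U'\subset U$; it is one-dimensional, oriented by $[U]>0$, and $G$ acts on it by conjugation of subgroups. An admissible $G$-module $W$ is polarizable if there is a symmetric positive definite $G$-equivariant pairing $W\otimes W\to\mathbb{Q}(\chi)$. *)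

(* Defs.v *)
From HB Require Import structures.
From mathcomp Require Import all_boot all_order all_algebra.
From mathcomp Require Import finmap all_classical topology.
(* The notations of mpoly clash with those of mathcomp-analysis. *)
From mathcomp.multinomials Require Import (canonicals) mpoly.
From mathcomp.multinomials Require Import freeg.

Set Implicit Arguments.
Unset Strict Implicit.
Unset Printing Implicit Defensive.

Import GRing.Theory Num.Theory.

Local Open Scope classical_set_scope.
Local Open Scope quotient_scope.
Local Open Scope ring_scope.

HB.mixin Record Topological_isTopGroup G & Group G & Topological G := {
  mulg_cts : continuous (fun x : G * G => (x.1 * x.2)%g);
  invg_cts : continuous (fun x : G => (x^-1)%g)
}.

#[short(type="topGroupType")]
HB.structure Definition TopGroup :=
  {G of Group G & Topological G & Topological_isTopGroup G}.

Section Subgroups.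
Variable G : topGroupType.
Implicit Types (U V : set G) (g : G).

Definition is_subgroup U := group_closed [in U].

Definition lcoset U g : set G := [set (g * u)%g | u in U].

Definition conjset g U : set G := [set (g * u * g^-1)%g | u in U].

(* [U : V] for V contained in U; this is 0 when there are infinitely many
   cosets, which does not happen for compact open subgroups. *)
Definition index U V : nat := #|` fset_set [set lcoset V g | g in U] |.

Definition compact_open_subgroup U := [/\ is_subgroup U, compact U & open U].

Record cosubgroup := COSubgroup {
  cos_set :> set G;
  cos_prop : compact_open_subgroup cos_set }.

HB.instance Definition _ := gen_eqMixin cosubgroup.
HB.instance Definition _ := gen_choiceMixin cosubgroup.

Lemma cos_inj : injective cos_set.
Proof.
move=> [U pU] [V pV] /= UV; subst V; congr COSubgroup; exact: Prop_irrelevance.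
Qed.

Lemma conjset1 U : conjset 1%g U = U.
Proof.
apply/seteqP; split=> [x [u Uu <-]|x Ux]; first by rewrite mul1g invg1 mulg1.
by exists x; rewrite // mul1g invg1 mulg1.
Qed.

Lemma conjsetM g h U : conjset (g * h)%g U = conjset g (conjset h U).
Proof.
apply/seteqP; split=> [x [u Uu <-]|x [_ [u Uu <-] <-]].
  by exists (h * u * h^-1)%g; [exists u|rewrite invgM !mulgA].
by exists u; rewrite // invgM !mulgA.
Qed.

Lemma conjsetK g : cancel (conjset g) (conjset g^-1%g).
Proof. by move=> U; rewrite -conjsetM mulVg conjset1. Qed.

Lemma conjset_preimage g U : conjset g U = (fun x => g^-1 * x * g)%g @^-1` U.
Proof.
apply/seteqP; split=> [_ [u Uu <-]|x /= Ux].
  by rewrite /= !mulgA mulVg mul1g mulgVK.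
by exists (g^-1 * x * g)%g; rewrite // !mulgA mulgV mul1g mulgK.
Qed.

Lemma mulg_left_cts g : continuous (fun x : G => g * x)%g.
Proof.
move=> x; apply: (@continuous_comp _ _ _ (fun y : G => (g, y))
  (fun y : G * G => y.1 * y.2)%g); last exact: mulg_cts.
by apply: cvg_pair; [exact: cvg_cst|exact: cvg_id].
Qed.

Lemma mulg_right_cts g : continuous (fun x : G => x * g)%g.
Proof.
move=> x; apply: (@continuous_comp _ _ _ (fun y : G => (y, g))
  (fun y : G * G => y.1 * y.2)%g); last exact: mulg_cts.
by apply: cvg_pair; [exact: cvg_id|exact: cvg_cst].
Qed.

Lemma conj_cts g : continuous (fun x : G => g * x * g^-1)%g.
Proof.
move=> x; apply: (@continuous_comp _ _ _ (fun y => g * y)%g (fun y => y * g^-1)%g).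
  exact: mulg_left_cts.
exact: mulg_right_cts.
Qed.

Lemma compact_open_conj g U :
  compact_open_subgroup U -> compact_open_subgroup (conjset g U).
Proof.
case=> -[U1 UV] cU oU; split.
- split.
    by apply/mem_set; exists 1%g; [exact/set_mem|rewrite mulg1 mulgV].
  move=> _ _ /set_mem[u Uu <-] /set_mem[v Uv <-].
  apply/mem_set; exists (u / v)%g.
    by apply/set_mem; apply: UV; exact/mem_set.
  by rewrite !invgM invgK !mulgA mulgVK.
- by apply: continuous_compact => //; apply: continuous_subspaceT; exact: conj_cts.
- rewrite conjset_preimage; apply: open_comp => // x _.
  by have := @conj_cts g^-1%g x; rewrite invgK.
Qed.

Definition conjcos g (U : cosubgroup) : cosubgroup :=
  COSubgroup (compact_open_conj g (cos_prop U)).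

Lemma lcoset_conj g U x :
  lcoset (conjset g U) (g * x * g^-1)%g = conjset g (lcoset U x).
Proof.
apply/seteqP; split=> [_ [_ [u Uu <-] <-]|_ [_ [u Uu <-] <-]].
  by exists (x * u)%g; [exists u|rewrite !mulgA mulgVK].
by exists (g * u * g^-1)%g; [exists u|rewrite !mulgA mulgVK].
Qed.

Lemma index_conj g U V : index (conjset g U) (conjset g V) = index U V.
Proof.
pose S := [set lcoset V x | x in U].
have E : [set lcoset (conjset g V) x | x in conjset g U] = conjset g @` S.
  apply/seteqP; split=> [_ [_ [u Uu <-] <-]|_ [_ [u Uu <-] <-]].
    by exists (lcoset V u); [exists u|rewrite lcoset_conj].
  by exists (g * u * g^-1)%g; [exists u|rewrite lcoset_conj].
rewrite /index E -/S.
have [fS|nfS] := pselect (finite_set S).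
  by rewrite fset_set_image// card_imfset //; exact: can_inj (conjsetK g).
rewrite /fset_set; case: pselect => [fgS|_]; last by case: pselect.
have := finite_image (conjset g^-1%g) fgS.
rewrite image_comp (_ : _ \o _ = id) ?image_id//.
by apply/funext => A /=; exact: conjsetK.
Qed.

End Subgroups.

Record gmodule (G : topGroupType) (W : lmodType rat) := GModule {
  gact :> G -> {linear W -> W};
  gact1 : forall w, gact 1%g w = w;
  gactM : forall g h w, gact (g * h)%g w = gact g (gact h w) }.

(* Finite dimensionality of V, when V is a linear subspace of W. *)
Definition fin_dim (W : lmodType rat) (V : set W) :=
  exists (m : nat) (e : 'I_m -> W), (forall i, V (e i)) /\
    forall w, V w -> exists c : 'I_m -> rat, w = \sum_i c i *: e i.

Section Modules.
Variables (G : topGroupType) (W : lmodType rat) (rho : gmodule G W).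

Definition stabilizer (w : W) : set G := [set g | rho g w = w].

Definition invariants (U : set G) : set W :=
  [set w | forall g, U g -> rho g w = w].

Definition smooth := forall w, open (stabilizer w).

Definition admissible :=
  smooth /\ forall U : set G, is_subgroup U -> open U -> fin_dim (invariants U).

End Modules.

Section Chi.
Variable G : topGroupType.
Implicit Types (U V : cosubgroup G) (g : G).

Local Notation free := {freeg (cosubgroup G) / rat}.

Definition chi_relators : set free :=
  [set D | exists U V, V `<=` U /\ D = << U >> - (index U V)%:R *: << V >>].

Definition chi_span : set free :=
  smallest (fun M => submod_closed [in M]) chi_relators.

Lemma chi_span_submod : submod_closed [in chi_span].
Proof.
split; first by apply/mem_set => M /= [[M0 _] _]; exact/set_mem.
move=> a u v /set_mem uS /set_mem vS; apply/mem_set => M /= MM.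
have [[M0 Ml] _] := MM.
by apply/set_mem/Ml; apply/mem_set; [exact: uS|exact: vS].
Qed.

Definition chi_pred : {pred free} := [in chi_span].

HB.instance Definition _ :=
  GRing.isSubmodClosed.Build rat free chi_pred chi_span_submod.

Definition Qchi := ring_quotient.Quotient.quot chi_pred.

HB.instance Definition _ := GRing.Zmodule.on Qchi.
HB.instance Definition _ := Quotient.on Qchi.

Definition chi_pi (D : free) : Qchi := \pi_Qchi D.

Lemma chi_piP D E : reflect (chi_pi D = chi_pi E) (D - E \in chi_pred).
Proof. by rewrite /chi_pi ring_quotient.Quotient.idealrBE; exact: eqP. Qed.

Lemma chi_pi_repr (x : Qchi) : chi_pi (repr x) = x.
Proof. exact: reprK. Qed.

Lemma chi_piD D E : chi_pi (D + E) = chi_pi D + chi_pi E.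
Proof. by rewrite /chi_pi !piE. Qed.

Definition chi_scale (a : rat) (x : Qchi) : Qchi := chi_pi (a *: repr x).

Lemma chi_piZ a D : chi_pi (a *: D) = chi_scale a (chi_pi D).
Proof.
apply/chi_piP; rewrite -scalerBr; apply: rpredZ.
by apply/chi_piP; rewrite chi_pi_repr.
Qed.

Lemma chi_scaleA a b x : chi_scale a (chi_scale b x) = chi_scale (a * b) x.
Proof. by rewrite -[x]chi_pi_repr -!chi_piZ scalerA. Qed.

Lemma chi_scale1 : left_id 1 chi_scale.
Proof. by move=> x; rewrite -[x]chi_pi_repr -!chi_piZ scale1r. Qed.

Lemma chi_scaleDr : right_distributive chi_scale +%R.
Proof.
move=> a x y; rewrite -[x]chi_pi_repr -[y]chi_pi_repr.
by rewrite -chi_piD -!chi_piZ scalerDr chi_piD.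
Qed.

Lemma chi_scaleDl x : {morph chi_scale^~ x : a b / a + b}.
Proof.
by move=> a b; rewrite -[x]chi_pi_repr -!chi_piZ scalerDl chi_piD.
Qed.

HB.instance Definition _ := GRing.Zmodule_isLmodule.Build rat Qchi
  chi_scaleA chi_scale1 chi_scaleDr chi_scaleDl.

Lemma chi_pi_linear : linear chi_pi.
Proof. by move=> a D E; rewrite chi_piD chi_piZ. Qed.

HB.instance Definition _ :=
  GRing.isLinear.Build rat free Qchi _ chi_pi chi_pi_linear.

Definition chi_gen U : Qchi := chi_pi << U >>.

Lemma chi_genE U V : V `<=` U -> chi_gen U = (index U V)%:R *: chi_gen V.
Proof.
move=> VU; rewrite /chi_gen -linearZ; apply/chi_piP.
by apply/mem_set; apply: sub_gen_smallest; exists U, V.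
Qed.

(* The orientation of the line Q(chi) for which every [U] is positive: the
   positive elements are the positive rational multiples of the [U]. *)
Definition chi_pos (x : Qchi) :=
  exists (c : rat) (U : cosubgroup G), 0 < c /\ x = c *: chi_gen U.

Definition chi_conj g : free -> Qchi := fglift (fun U => chi_gen (conjcos g U)).

Lemma chi_conjU g U : chi_conj g << U >> = chi_gen (conjcos g U).
Proof. by rewrite /chi_conj liftU scale1r. Qed.

Lemma chi_conj_zmod g : zmod_morphism (chi_conj g).
Proof. by move=> D E; rewrite /chi_conj lift_is_additive. Qed.

HB.instance Definition _ g :=
  GRing.isZmodMorphism.Build free Qchi (chi_conj g) (chi_conj_zmod g).

Lemma chi_conjZ g : scalable (chi_conj g).
Proof.
move=> a D; rewrite -[D]freeg_sumE scaler_sumr !raddf_sum.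
apply: eq_bigr => U _ /=.
have -> : a *: << coeff U D *g U >> = << a * coeff U D *g U >> :> free.
  by apply/eqP/freeg_eqP => V; rewrite coeffZ !coeffU mulrA.
by rewrite /chi_conj !liftU scalerA.
Qed.

HB.instance Definition _ g :=
  GRing.isScalable.Build rat free Qchi _ (chi_conj g) (chi_conjZ g).

Lemma chi_conj_rel g D : D \in chi_pred -> chi_conj g D = 0.
Proof.
move=> /set_mem DS; pose M := [set D | chi_conj g D = 0].
apply: (DS M); split=> [|_ [U [V [VU ->]]]].
  split; first by apply/mem_set; rewrite /M /= linear0.
  move=> a u v /set_mem uM /set_mem vM; apply/mem_set.
  by rewrite /M /= linearP /= [chi_conj g u]uM [chi_conj g v]vM scaler0 addr0.
rewrite /M /= linearB linearZ /= !chi_conjU.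
have sVU : conjcos g V `<=` conjcos g U by exact: image_subset.
by rewrite (chi_genE sVU) /= index_conj subrr.
Qed.

(* chi_conj kills chi_span (chi_conj_rel), so this does not depend on the
   chosen representative: see chi_act_pi. *)
Definition chi_act g (x : Qchi) : Qchi := chi_conj g (repr x).

Lemma chi_act_pi g D : chi_act g (chi_pi D) = chi_conj g D.
Proof.
apply/eqP; rewrite -subr_eq0 -linearB; apply/eqP/chi_conj_rel.
by apply/chi_piP; rewrite chi_pi_repr.
Qed.

Lemma chi_act_linear g : linear (chi_act g).
Proof.
move=> a x y; rewrite -[x]chi_pi_repr -[y]chi_pi_repr -linearP !chi_act_pi.
exact: linearP.
Qed.

HB.instance Definition _ g :=
  GRing.isLinear.Build rat Qchi Qchi _ (chi_act g) (chi_act_linear g).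

Lemma chi_act_gen g U : chi_act g (chi_gen U) = chi_gen (conjcos g U).
Proof. by rewrite chi_act_pi chi_conjU. Qed.

Lemma chi_ind (f h : {linear Qchi -> Qchi}) :
  (forall U, f (chi_gen U) = h (chi_gen U)) -> f =1 h.
Proof.
move=> fh x; rewrite -[x]chi_pi_repr -[repr x]freeg_sumE !linear_sum.
apply: eq_bigr => U _ /=.
have -> : << coeff U (repr x) *g U >> = coeff U (repr x) *: << U >> :> free.
  by apply/eqP/freeg_eqP => V; rewrite coeffZ !coeffU mul1r.
by rewrite !linearZ /= -/(chi_gen U) fh.
Qed.

Lemma chi_act1 x : chi_act 1%g x = x.
Proof.
apply: (@chi_ind (chi_act 1%g) idfun) => U; rewrite /= chi_act_gen.
by congr chi_gen; apply: cos_inj; exact: conjset1.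
Qed.

Lemma chi_actM g h x : chi_act (g * h)%g x = chi_act g (chi_act h x).
Proof.
apply: (@chi_ind (chi_act (g * h)%g) (chi_act g \o chi_act h)) => U.
rewrite /= !chi_act_gen.
by congr chi_gen; apply: cos_inj; exact: conjsetM.
Qed.

(* By chi_act_gen, g maps [U] to [g U g^-1]. *)
Definition chi_module : gmodule G Qchi :=
  @GModule G Qchi (fun g => chi_act g) chi_act1 chi_actM.

End Chi.

Definition polarization (G : topGroupType) (W : lmodType rat)
    (rho : gmodule G W) (B : {bilinear W -> W -> Qchi G}) :=
  [/\ forall v w, B v w = B w v,
      forall g v w, B (rho g v) (rho g w) = chi_module G g (B v w)
    & forall w, w != 0 -> chi_pos (B w w)].

Definition polarizable (G : topGroupType) (W : lmodType rat)
    (rho : gmodule G W) :=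
  admissible rho /\ exists B, polarization rho B.

Section Extension.
Variables (k F : fieldType) (iota : {rmorphism k -> F}).

Definition adjoin (A : set F) : set F :=
  smallest (fun L => divring_closed [in L]) (range iota `|` A).

Definition algebraic_over (K : set F) (x : F) :=
  exists p : {poly F}, [/\ p != 0, forall i, K p`_i & root p x].

Definition alg_independent n (t : 'I_n -> F) :=
  forall p : mpoly.mpoly n k, mpoly.mmap iota t p = 0 -> p = 0.

Definition has_trdeg n :=
  exists t : 'I_n -> F, alg_independent t /\
    forall x, algebraic_over (adjoin (range t)) x.

(* Aut(F/k). The inverse is stored for convenience; it is determined by the
   underlying function: see autP. *)
Record autOver := AutOver {
  aut_fun :> F -> F;
  aut_inv : F -> F;
  aut_zmod : zmod_morphism aut_fun;
  aut_monoid : monoid_morphism aut_fun;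
  aut_funK : cancel aut_fun aut_inv;
  aut_invK : cancel aut_inv aut_fun;
  aut_base : forall c, aut_fun (iota c) = iota c }.

HB.instance Definition _ := gen_eqMixin autOver.
HB.instance Definition _ := gen_choiceMixin autOver.

Lemma autP (g h : autOver) : g =1 h -> g = h.
Proof.
move=> gh.
have E : aut_fun g = aut_fun h by exact/funext.
have E' : aut_inv g = aut_inv h.
  by apply/funext => x; rewrite -{1}[x](aut_invK h) -E aut_funK.
case: g h {gh} E E' => [g g' ? ? ? ? ?] [h h' ? ? ? ? ?] /= E E'.
by subst h h'; congr AutOver; exact: Prop_irrelevance.
Qed.

Fact aut_one_subproof : monoid_morphism (@id F). Proof. by []. Qed.

Definition aut_one : autOver := @AutOver id id (fun _ _ => erefl)
  aut_one_subproof (fun _ => erefl) (fun _ => erefl) (fun _ => erefl).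

Program Definition aut_mul (g h : autOver) : autOver :=
  @AutOver (g \o h) (aut_inv h \o aut_inv g) _ _ _ _ _.
Next Obligation. by move=> g h x y /=; rewrite !aut_zmod. Qed.
Next Obligation.
move=> g h; split=> [|x y] /=; first by rewrite (aut_monoid h).1 (aut_monoid g).1.
by rewrite (aut_monoid h).2 (aut_monoid g).2.
Qed.
Next Obligation. by move=> g h x /=; rewrite !aut_funK. Qed.
Next Obligation. by move=> g h x /=; rewrite !aut_invK. Qed.
Next Obligation. by move=> g h c /=; rewrite !aut_base. Qed.

Program Definition aut_opp (g : autOver) : autOver :=
  @AutOver (aut_inv g) g _ _ _ _ _.
Next Obligation.
by move=> g x y; apply: (can_inj (aut_funK g)); rewrite aut_zmod !aut_invK.
Qed.
Next Obligation.
move=> g; split=> [|x y]; apply: (can_inj (aut_funK g)).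
  by rewrite aut_invK (aut_monoid g).1.
by rewrite (aut_monoid g).2 !aut_invK.
Qed.
Next Obligation. by move=> g; exact: aut_invK. Qed.
Next Obligation. by move=> g; exact: aut_funK. Qed.
Next Obligation.
by move=> g c; apply: (can_inj (aut_funK g)); rewrite aut_invK aut_base.
Qed.

Fact aut_mulA : associative aut_mul. Proof. by move=> f g h; exact: autP. Qed.
Fact aut_mul1 : left_id aut_one aut_mul. Proof. by move=> g; exact: autP. Qed.
Fact aut_1mul : right_id aut_one aut_mul. Proof. by move=> g; exact: autP. Qed.
Fact aut_mulV : left_inverse aut_one aut_opp aut_mul.
Proof. by move=> g; apply: autP => x /=; rewrite aut_funK. Qed.
Fact aut_Vmul : right_inverse aut_one aut_opp aut_mul.
Proof. by move=> g; apply: autP => x /=; rewrite aut_invK. Qed.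

HB.instance Definition _ := isGroup.Build autOver
  aut_mulA aut_mul1 aut_1mul aut_mulV aut_Vmul.

Lemma autM (g h : autOver) x : (g * h)%g x = g (h x). Proof. by []. Qed.
Lemma aut1 x : (1%g : autOver) x = x. Proof. by []. Qed.
Lemma autKV (g : autOver) x : g ((g^-1)%g x) = x.
Proof. exact: aut_invK. Qed.
Lemma autK (g : autOver) x : (g^-1)%g (g x) = x.
Proof. exact: aut_funK. Qed.

Definition aut_fix (K : set F) : set autOver :=
  [set g | forall x, K x -> g x = x].

(* Group topology in which the Aut(F/k(x)) generate the neighbourhoods of 1:
   the left translates of these subgroups form a subbase of open sets. *)
Definition aut_subbase : set (set autOver) :=
  [set A | exists (g : autOver) (x : F),
     A = [set (g * u)%g | u in aut_fix (adjoin [set x])]].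

HB.instance Definition _ :=
  @isSubBaseTopological.Build autOver (set autOver) aut_subbase id.

Lemma adjoin_fixP (g : autOver) (A : set F) :
  aut_fix (adjoin A) g <-> forall x, A x -> g x = x.
Proof.
split=> [gA x Ax|gA]; first by apply: gA; apply: sub_gen_smallest; right.
move=> x /(_ [set y | g y = y]); apply; split=> [|y [[c _ <-]|/gA]]; rewrite /= ?aut_base//.
have gB y z : g (y - z) = g y - g z by exact: aut_zmod.
have gM y z : g (y * z) = g y * g z by rewrite (aut_monoid g).2.
have g1 : g 1 = 1 by rewrite (aut_monoid g).1.
have g0 : g 0 = 0 by have := gB 0 0; rewrite !subrr.
split=> [|y z|y z]; rewrite ?inE //= => yE zE; first by rewrite gB yE zE.
rewrite gM yE; congr (_ * _).
have [->|z0] := eqVneq z 0; first by rewrite invr0.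
by apply: (mulfI z0); rewrite -{1}zE -gM !divff.
Qed.

Lemma aut_subbaseE (g : autOver) x :
  [set (g * u)%g | u in aut_fix (adjoin [set x])] = [set h | h x = g x].
Proof.
apply/seteqP; split=> [_ [u /adjoin_fixP ux <-]|h /= hx].
  by rewrite /= ux.
exists (g^-1 * h)%g; last by rewrite mulgA mulgV mul1g.
by apply/adjoin_fixP => _ ->; rewrite autM hx autK.
Qed.

Lemma aut_cvgP (E : set_system autOver) (g : autOver) : Filter E ->
  E --> g <-> forall x, E [set h : autOver | h x = g x].
Proof.
move=> FE; split=> [Eg x|Eg].
  apply: Eg; exists [set h : autOver | h x = g x]; split=> //.
  exists [set [set h : autOver | h x = g x]]; last by rewrite bigcup_set1.
  move=> _ ->; apply: (@finI_from1 _ _ aut_subbase id).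
  by exists g, x; rewrite aut_subbaseE.
move=> A /= [B [[D Dsub <-] [C DC Cg] BA]].
apply: filterS BA _; apply: (@filterS _ _ _ C); first by move=> h Ch; exists C.
have [D' D'sub CE] := Dsub _ DC; rewrite -CE in Cg *.
apply: filter_bigI => B' /[dup] B'D' /D'sub/set_mem[f [x B'E]].
have BE : B' = [set h | h x = f x] by rewrite B'E aut_subbaseE.
have : B' g := Cg _ B'D'; rewrite BE /= => gE.
by rewrite -gE; exact: Eg.
Qed.

Lemma aut_nbhs (g : autOver) x : nbhs g [set h : autOver | h x = g x].
Proof. by move: x; apply/aut_cvgP => //; exact: cvg_id. Qed.

Lemma aut_mul_cts : continuous (fun x : autOver * autOver => (x.1 * x.2)%g).
Proof.
move=> [g h]; apply/aut_cvgP => x /=.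
exists ([set f : autOver | f (h x) = g (h x)], [set f : autOver | f x = h x]).
  by split; exact: aut_nbhs.
by move=> [g' h'] [/= gE hE]; rewrite hE gE.
Qed.

Lemma aut_inv_cts : continuous (fun x : autOver => (x^-1)%g).
Proof.
move=> g; have FF := fmap_filter (fun x : autOver => (x^-1)%g) (nbhs_filter g).
apply/aut_cvgP => x /=.
apply: filterS (aut_nbhs g ((g^-1)%g x)) => h /= hE.
by rewrite -{1}(autKV g x) -hE; exact: autK.
Qed.

HB.instance Definition _ :=
  Topological_isTopGroup.Build autOver aut_mul_cts aut_inv_cts.

End Extension.

(* Main.v *)
(* Let W <> 0. Choose a subfield C of F, algebraically closed in F, and u such that
   F is algebraic over C(u) but not over C. The kernel of the action of Aut(F/C) on
   W is an open normal subgroup, and it contains Aut(F/C(t)) for every t outside C: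
   it contains Aut(F/L) for some L = C(t, y), and if m is the index of the kernel in
   Aut(F/C(t)), which does not depend on t, then m divides the degree [L : C(s)] for
   every s in L outside C; a projection from a smooth point of a plane model of L
   provides degrees with greatest common divisor 1.

   For every prime p there is sigma_p in Aut(F/C) with sigma_p(u) = u^p. These
   automorphisms commute up to Aut(F/C(u)), so they commute on W, and sigma_p
   multiplies the class of a compact open subgroup, hence the polarization, by p.
   Commuting similitudes of a positive definite rational form, one of ratio p for
   every prime p, have a common complex eigenvector; this writes every prime p as
   a sum of two squares in a fixed real number field, which is impossible for some
   p = 3 modulo 4. *)

From HB Require Import structures.
Require Import Defs.
From mathcomp Require Import all_boot all_order all_algebra all_field.
From mathcomp Require Import finmap all_classical topology.
From mathcomp Require Import ring zify.
From mathcomp.multinomials Require Import freeg.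
From mathcomp.multinomials Require Import (canonicals) mpoly.

Set Implicit Arguments.
Unset Strict Implicit.
Unset Printing Implicit Defensive.

Import Order.TTheory GRing.Theory Num.Theory.
Local Open Scope classical_set_scope.
Local Open Scope ring_scope.

(** * Sums of two squares and real number fields *)

(** No single sigma_p is contradictory, nor is an arbitrary family: by quaternions the sum of four
    squares on Q^4 has a similitude of every prime ratio. Commutativity is thus essential, and it
    explains the detour through the kernel: an extension of u -> u^p to F is determined only up to
    Aut(F/C(u)), so this group must be known to act trivially. Positivity is essential too: it leads
    to a real number field, whereas in Q(i) every number is a sum of two squares. Finite dimension
    makes the kernel open. Its normality lets the transcendental t be replaced by any other one, and
    this freedom is what varies the degrees. The scalar by which sigma_p acts on Q(chi) is read off
    on Aut(F/k(u, r)), where r is a finite list such that C is the algebraic closure of k(r) in F;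
    the group Aut(F/C(u)) need not be open in Aut(F/k). *)

Lemma dvdz_Fp (p : nat) (A : int) : prime p ->
  (p %| A)%Z = ((A%:~R : 'F_p) == 0).
Proof. by move=> pr; rewrite (dvdz_pcharf (pchar_Fp pr)). Qed.

(** Otherwise -1 would be a square x^2 modulo p, and x^(p-1) = 1 would contradict (-1)^((p-1)/2) =
    -1, the exponent being odd. *)
Lemma dvdz_sum2sq (p : nat) (A B : int) : prime p -> (p %% 4 = 3)%N ->
  (p %| A ^+ 2 + B ^+ 2)%Z -> (p %| A)%Z /\ (p %| B)%Z.
Proof.
move=> pr p3; rewrite !dvdz_Fp // rmorphD !rmorphXn /=.
set a := A%:~R; set b := B%:~R => /eqP ab.
suff b0 : b == 0.
  by split=> //; move: ab; rewrite (eqP b0) expr0n addr0 => /eqP; rewrite sqrf_eq0.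
apply/eqP/eqP; apply: contraT => b0.
pose x : 'F_p := a / b.
have x2 : x ^+ 2 = -1.
  rewrite expr_div_n (_ : a ^+ 2 = - b ^+ 2) ?mulNr ?divff ?sqrf_eq0//.
  by apply/eqP; rewrite -addr_eq0 ab.
have x0 : x != 0 by apply: contra_eq_neq x2 => ->; rewrite expr0n eq_sym oppr_eq0 oner_eq0.
have pE : p.-1 = ((p %/ 4 * 2 + 1) * 2)%N.
  by rewrite {1}(divn_eq p 4) p3; lia.
have x1 : x ^+ p.-1 = 1.
  have := expf_card x; rewrite card_Fp // => xp.
  by apply: (mulfI x0); rewrite -exprS prednK ?prime_gt0 // xp mulr1.
move: x1; rewrite pE mulnC exprM x2 exprD mulnC exprM sqrrN !expr1n mul1r => /eqP.
rewrite eq_sym -subr_eq0 opprK -mulr2n -[1 *+ 2]/(2%:~R : 'F_p) -dvdz_Fp //.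
by move=> p2; have /dvdn_leq : (p %| 2)%N by []; have := prime_gt1 pr; lia.
Qed.

(** The p-adic valuation of A^2 + B^2 is even, that of p M^2 is odd. The bound on K is crude: it
    keeps the error term p^K C out of reach while each step of the descent divides A, B and M by p
    and lowers K by 2. *)
Lemma sum2sq_odd (p : nat) (M A B C : int) (K : nat) : prime p -> (p %% 4 = 3)%N ->
  M != 0 -> (K > 2 * `|M|)%N ->
  A ^+ 2 + B ^+ 2 = p%:Z * M ^+ 2 + p%:Z ^+ K * C -> False.
Proof.
move=> pr p3; have [n] := ubnP `|M|%N.
elim: n M A B C K => // n IH M A B C K Mn M0 KM E.
have p0 : p%:Z != 0 by have := prime_gt0 pr; lia.
have pAB : (p %| A ^+ 2 + B ^+ 2)%Z.
  rewrite E; apply: rpredD; first by rewrite dvdz_mulr.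
  by rewrite dvdz_mulr // dvdz_exp //; lia.
have [/dvdzP[a aE] /dvdzP[b bE]] := dvdz_sum2sq pr p3 pAB.
case: K KM E => [|[|K]] KM E; [lia|lia|].
have E1 : p%:Z * (a ^+ 2 + b ^+ 2) = M ^+ 2 + p%:Z ^+ K.+1 * C.
  by apply: (mulfI p0); transitivity (A ^+ 2 + B ^+ 2);
    [rewrite aE bE; ring|rewrite E (exprS _ K.+1); ring].
have : (p %| M ^+ 2)%Z.
  have -> : M ^+ 2 = p%:Z * (a ^+ 2 + b ^+ 2) - p%:Z ^+ K.+1 * C by rewrite E1; ring.
  by apply: rpredB; rewrite dvdz_mulr // dvdz_exp.
rewrite dvdzE /= abszX Euclid_dvdX // => /andP[+ _].
rewrite -[p in (p %| _)%N]/(`|p%:Z|%N) -dvdzE => /dvdzP[m mE].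
have m0 : m != 0 by apply: contra_neq M0 => m0; rewrite mE m0 mul0r.
have lt : (`|m| < `|M|)%N.
  by rewrite mE abszM /= -[X in (X < _)%N]muln1 ltn_pmul2l ?absz_gt0 // prime_gt1.
apply: (IH m a b C K) => //; [lia|lia|].
by apply: (mulfI p0); rewrite E1 mE (exprS _ K); ring.
Qed.

Lemma horner_taylor2 (R : comNzRingType) (h : {poly R}) (t e : R) :
  exists c, h.[t + e] = h.[t] + e * h^`().[t] + e ^+ 2 * c.
Proof.
elim/poly_ind: h => [|q c [d IH]]; first by exists 0; rewrite deriv0 !horner0; ring.
exists (q^`().[t] + (t + e) * d).
by rewrite derivD derivM derivX derivC addr0 mulr1 !hornerE /= IH; ring.
Qed.

Lemma hensel_int (p : nat) (h : {poly int}) (t0 : int) K : prime p ->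
  (p %| h.[t0])%Z -> ~~ (p %| h^`().[t0])%Z ->
  exists t, (p%:Z ^+ K %| h.[t])%Z /\ (p %| h.[t])%Z /\ ~~ (p %| h^`().[t])%Z.
Proof.
move=> pr ht0 dt0; elim: K => [|K [t [/dvdzP[a aE] [ht dt]]]].
  by exists t0; rewrite expr0 dvd1z.
case: K aE => [|K] aE; first by exists t; rewrite expr1.
(* Newton correction: h(t) = a p^(K+1), and replacing t by t + p^(K+1) w changes a into a + w h'(t)
   modulo p. *)
pose w : 'F_p := - a%:~R / (h^`().[t])%:~R.
have [c cE] := horner_taylor2 h t (p%:Z ^+ K.+1 * (w : nat)%:Z).
pose t1 := t + p%:Z ^+ K.+1 * (w : nat)%:Z.
have div1 : (p%:Z ^+ K.+2 %| h.[t1])%Z.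
  rewrite /t1 cE aE exprMn -exprM.
  have -> : a * p%:Z ^+ K.+1 + p%:Z ^+ K.+1 * (w : nat)%:Z * h^`().[t] +
    p%:Z ^+ (K.+1 * 2) * (w : nat)%:Z ^+ 2 * c =
    p%:Z ^+ K.+1 * (a + (w : nat)%:Z * h^`().[t]) +
    p%:Z ^+ K.+2 * (p%:Z ^+ K * (w : nat)%:Z ^+ 2 * c).
    by rewrite (_ : K.+1 * 2 = K.+2 + K)%N ?exprD; [ring|lia].
  apply: rpredD; last by rewrite dvdz_mulr.
  rewrite (exprSr _ K.+1); apply: dvdz_mul.
    exact: dvdzz.
  rewrite dvdz_Fp // rmorphD rmorphM /=.
  rewrite -[X in X * _]/((w : nat)%:R : 'F_p) natr_Zp.
  by rewrite /w divfK ?subrr ?addrN // -dvdz_Fp.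
exists t1; split=> //; split.
  by apply: dvdz_trans div1; rewrite exprS dvdz_mulr.
have [d dE] := horner_taylor2 h^`() t (p%:Z ^+ K.+1 * (w : nat)%:Z).
rewrite dvdz_Fp // /t1 dE exprMn !rmorphD !rmorphM !rmorphXn /=.
have -> : (p%:~R : 'F_p) = 0 by apply/eqP; rewrite -dvdz_Fp // dvdzz.
by rewrite exprS !(mul0r, expr0n, addr0, mulr0) -dvdz_Fp.
Qed.

(** A root of h modulo a high power of p, given by Hensel's lemma, stands for a ring morphism from
    Z[x]/(h) to the p-adic integers. *)
Lemma sum2sq_poly_int (p : nat) (h X Y Q : {poly int}) (M t0 : int) :
  prime p -> (p %% 4 = 3)%N -> M != 0 ->
  (p %| h.[t0])%Z -> ~~ (p %| h^`().[t0])%Z ->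
  X ^+ 2 + Y ^+ 2 = (p%:Z * M ^+ 2)%:P + h * Q -> False.
Proof.
move=> pr p3 M0 ht0 dt0 E.
have [t [/dvdzP[c cE] _]] := hensel_int (2 * `|M|).+1 pr ht0 dt0.
apply: (@sum2sq_odd p M X.[t] Y.[t] (c * Q.[t]) (2 * `|M|).+1) => //.
by rewrite -!horner_exp -hornerD E hornerD hornerM hornerC cE; ring.
Qed.

Lemma sum2sq_poly_rat (p : nat) (h : {poly int}) (X Y Q : {poly rat}) (t0 : int) :
  prime p -> (p %% 4 = 3)%N ->
  (p %| h.[t0])%Z -> ~~ (p %| h^`().[t0])%Z ->
  X ^+ 2 + Y ^+ 2 = p%:R%:P + map_poly intr h * Q -> False.
Proof.
move=> pr p3 ht0 dt0 E.
have [X1 [a a0 XE]] := rat_poly_scale X.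
have [Y1 [b b0 YE]] := rat_poly_scale Y.
have [Q1 [c c0 QE]] := rat_poly_scale Q.
pose f := map_poly (intr : int -> rat).
have f_inj : injective f by apply: map_inj_poly => //; exact: intr_inj.
(* The identity is multiplied by (a b c)^2 to clear denominators, which puts M = a b c next to p. *)
apply: (@sum2sq_poly_int p h ((b * c)%:P * X1) ((a * c)%:P * Y1)
  ((a ^+ 2 * b ^+ 2 * c)%:P * Q1) (a * b * c) t0) => //.
  by rewrite !mulf_neq0.
have nz (z : int) : z != 0 -> (z%:~R : rat) != 0 by rewrite intr_eq0.
apply: f_inj; rewrite /f !(rmorphD, rmorphM, rmorphXn) /= !map_polyC /= ?intrM ?rmorphXn /= -?pmulrn.
have XE1 : map_poly intr X1 = a%:~R%:P * X by rewrite XE mul_polyC scalerA divff ?scale1r ?nz.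
have YE1 : map_poly intr Y1 = b%:~R%:P * Y by rewrite YE mul_polyC scalerA divff ?scale1r ?nz.
have QE1 : map_poly intr Q1 = c%:~R%:P * Q by rewrite QE mul_polyC scalerA divff ?scale1r ?nz.
rewrite XE1 YE1 QE1 ?polyCM ?polyC_exp.
transitivity ((a%:~R%:P * b%:~R%:P * c%:~R%:P) ^+ 2 * (X ^+ 2 + Y ^+ 2)); first by ring.
by rewrite E; ring.
Qed.

Lemma prime_3mod4 n : (n %% 4 = 3)%N -> exists p, [/\ prime p, (p %% 4 = 3)%N & (p %| n)%N].
Proof.
have [m] := ubnP n; elim: m n => // m IH n nm n3.
have n1 : (n > 1)%N by case: n n3 {nm} => [|[|n]].
have pr := pdiv_prime n1; have dv := pdiv_dvd n.
have [q3|q3] := eqVneq (pdiv n %% 4)%N 3%N; first by exists (pdiv n).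
case/dvdnP: dv => k kE.
have pos := prime_gt1 pr.
have qk : (k < n)%N by rewrite [in ltnRHS]kE; nia.
have k3 : (k %% 4 = 3)%N.
  move: (n3); rewrite kE -modnMm.
  have := ltn_pmod (pdiv n) (isT : (0 < 4)%N); have := ltn_pmod k (isT : (0 < 4)%N).
  by move: q3; case: (pdiv n %% 4)%N => [|[|[|[|]]]]//; case: (k %% 4)%N => [|[|[|[|]]]].
have [|p [pp p3 pk]] := IH k _ k3; first lia.
by exists p; split=> //; rewrite kE dvdn_mulr.
Qed.

Lemma horner_bound (R : numDomainType) (q : {poly R}) (x0 : R) :
  exists2 B : R, 0 <= B & forall x, `|x - x0| <= 1 -> `|q.[x]| <= B.
Proof.
elim/poly_ind: q => [|q c [B B0 qB]]; first by exists 0 => // x _; rewrite horner0 normr0.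
exists (B * (1 + `|x0|) + `|c|) => [|x xx0].
  by rewrite addr_ge0 ?mulr_ge0 ?addr_ge0.
rewrite hornerMXaddC (le_trans (ler_normD _ _)) // lerD2r normrM.
apply: ler_pM => //; first exact: qB.
by rewrite -[x](subrK x0) (le_trans (ler_normD _ _)) // lerD2r.
Qed.

(** Successive numerators differ by M, so the fractions of denominator M^(K+2) have spacing
    M^(-K-1). An exponent at least 2 leaves one factor M to absorb the leading coefficient in
    [real_field_prime_sum2sq]. *)
Lemma real_approx (x y : algC) (M : int) : x \is Num.real -> y \is Num.real -> x < y ->
  (1 < M) -> exists (c : int) (K : nat),
  x < (1 + M * c)%:~R / (M ^+ K.+2)%:~R < y.
Proof.
move=> xR yR xy M1.
have M0 : (0 : algC) < M%:~R by rewrite ltr0z; lia.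
have d0 : 0 < y - x by rewrite subr_gt0.
pose z := (M%:~R + 1) / (y - x).
have z0 : 0 <= z by rewrite divr_ge0 ?(ltW d0) // addr_ge0 // ltW.
pose K := Num.bound z.
have zK : z < K%:R by exact: archi_boundP.
have KM : (K%:Z <= M ^+ K.+2)%R.
  have : (K < 2 ^ K.+2)%N by rewrite (leq_trans (ltn_expl K (isT : (1 < 2)%N))) ?leq_exp2l //; lia.
  move=> KK; apply: (@le_trans _ _ (2 ^+ K.+2)); last by rewrite lerXn2r ?nnegrE //; lia.
  by rewrite -natz -natrX ler_nat ltnW.
pose b : algC := (M ^+ K.+2)%:~R.
have Kb : K%:R <= b by rewrite /b -[K%:R]/(K%:Z%:~R : algC) ler_int.
have b0 : 0 < b by rewrite /b ltr0z exprn_gt0 //; lia.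
have bxy : M%:~R + 1 < b * (y - x).
  by rewrite -ltr_pdivrMr //; apply: lt_le_trans Kb.
pose w := (b * x - 1) / M%:~R.
have wR : w \is Num.real by rewrite rpredM ?rpredV ?rpredB ?rpredM ?rpred_int ?rpred1.
pose c := Num.floor w + 1.
exists c, K; rewrite -/b ltr_pdivlMr // ltr_pdivrMr // rmorphD rmorphM /=.
have c1 : w < c%:~R by exact: real_floorD1_gt.
have c2 : c%:~R <= w + 1 by rewrite /c rmorphD /= lerD2r real_ge_floor.
have wE : M%:~R * w = b * x - 1 by rewrite /w mulrC divfK // gt_eqF.
apply/andP; split.
  by rewrite mulrC -(subrK 1 (b * x)) -wE addrC ltrD2l ltr_pM2l.
have : M%:~R * c%:~R <= M%:~R * (w + 1) by rewrite ler_pM2l.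
rewrite mulrDr wE mulr1 => cb.
rewrite [y * b]mulrC [X in _ < X](_ : _ = b * x + b * (y - x)); last by rewrite -mulrDr addrC subrK.
apply: (@le_lt_trans _ _ (1%:~R + (b * x - 1 + M%:~R))); first by rewrite lerD2l.
rewrite [X in X < _](_ : _ = b * x + M%:~R); last by rewrite rmorph1; ring.
by rewrite ltrD2l; apply: lt_trans bxy; rewrite ltrDl.
Qed.

Local Notation QtoC := (ratr : rat -> algC).

(** Write h = (X - theta) g with g(theta) nonzero: near theta the sign of g is constant, and the
    fraction is taken on the side of theta where the product is negative. *)
Lemma simple_root_neg (theta : algC) (h : {poly rat}) (M : int) :
  theta \is Num.real -> root (map_poly QtoC h) theta ->
  (map_poly QtoC h)^`().[theta] != 0 -> 1 < M ->
  exists (c : int) (K : nat), h.[(1 + M * c)%:~R / (M ^+ K.+2)%:~R] < 0.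
Proof.
move=> thR /factor_theorem[g gE] dh0 M1.
have gth : (map_poly QtoC h)^`().[theta] = g.[theta].
  by rewrite gE derivM derivXsubC mulr1 hornerD hornerM hornerXsubC subrr mulr0 add0r.
rewrite {}gth in dh0.
have hR (p : {poly rat}) x : x \is Num.real -> (map_poly QtoC p).[x] \is Num.real.
  move=> xR; rewrite horner_coef; apply: rpred_sum => i _.
  by rewrite coef_map /=; apply: rpredM; [exact/Creal_Crat/Crat_rat|exact: rpredX].
have gthR : g.[theta] \is Num.real.
  suff -> : g.[theta] = (map_poly QtoC h)^`().[theta] by rewrite deriv_map hR.
  by rewrite gE derivM derivXsubC mulr1 hornerD hornerM hornerXsubC subrr mulr0 add0r.
have /factor_theorem[q qE] : root (g - g.[theta]%:P) theta by rewrite rootE !hornerE subrr.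
have [B B0 qB] := horner_bound q theta.
pose G := `|g.[theta]|; have G0 : 0 < G by rewrite normr_gt0.
(* [ep <= 1] keeps t where [B] bounds [q], and [ep * B < G] then prevents g(t) from changing
   sign. *)
pose ep := G / (B + 1 + G).
have den0 : 0 < B + 1 + G by rewrite addr_gt0 // ltr_wpDl.
have ep0 : 0 < ep by rewrite divr_gt0.
have ep1 : ep <= 1 by rewrite ler_pdivrMr // mul1r lerDr addr_ge0.
have epB : ep * B < G.
  rewrite /ep mulrAC ltr_pdivrMr // ltr_pM2l // -addrA ltrDl addr_gt0 //.
have epR : ep \is Num.real by rewrite realE ltW.
have near t : `|t - theta| < ep -> `|g.[t] - g.[theta]| < G.
  move=> tt; have -> : g.[t] - g.[theta] = q.[t] * (t - theta).
    by have := congr1 (fun p => p.[t]) qE; rewrite /= !hornerE.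
  rewrite normrM mulrC; apply: le_lt_trans epB; apply: ler_pM => //; first exact: ltW.
  by apply: qB; apply: le_trans ep1; exact: ltW.
have hE t : (map_poly QtoC h).[t] = g.[t] * (t - theta) by rewrite gE !hornerE.
have gR t : t \is Num.real -> t != theta -> g.[t] \is Num.real.
  move=> tR tth; have := hR h t tR; rewrite hE => gtR.
  by rewrite -[g.[t]](mulfK (_ : t - theta != 0)) ?subr_eq0 // rpredM // rpredV rpredB.
have fin c K : (map_poly QtoC h).[(1 + M * c)%:~R / (M ^+ K.+2)%:~R] < 0 ->
    h.[(1 + M * c)%:~R / (M ^+ K.+2)%:~R] < 0.
  by rewrite -!(ratr_int algC) -fmorph_div /= horner_map /= ltrq0.
have tR c K : (1 + M * c)%:~R / (M ^+ K.+2)%:~R \is @Num.real algC.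
  by rewrite rpredM ?rpredV ?rpred_int.
have [gpos|gneg|/eqP] := real_ltgtP (@real0 algC) gthR; last by rewrite eq_sym (negPf dh0).
- have := @real_approx (theta - ep) theta M (rpredB thR epR) thR.
  rewrite ltrBlDr ltrDl => /(_ ep0 M1)[c [K /andP[]]]; set t := _ / _ => t1 t2.
  exists c, K; apply: fin; rewrite -/t hE.
  have tth : `|t - theta| < ep.
    by rewrite distrC gtr0_norm ?subr_gt0 // ltrBlDr addrC -ltrBlDr.
  have gtR : g.[t] \is Num.real by apply: gR; [exact: tR|rewrite lt_eqF].
  have := near t tth; rewrite real_ltr_norml ?rpredB //.
  rewrite /G gtr0_norm // ltrBrDl subrr => /andP[gt0 _].
  by rewrite pmulr_rlt0 // subr_lt0.
- have := @real_approx theta (theta + ep) M thR (rpredD thR epR).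
  rewrite ltrDl => /(_ ep0 M1)[c [K /andP[]]]; set t := _ / _ => t1 t2.
  exists c, K; apply: fin; rewrite -/t hE.
  have tth : `|t - theta| < ep.
    by rewrite gtr0_norm ?subr_gt0 // ltrBlDl.
  have gtR : g.[t] \is Num.real by apply: gR; [exact: tR|rewrite gt_eqF].
  have := near t tth; rewrite real_ltr_norml ?rpredB //.
  rewrite /G ltr0_norm // ltrBlDr addNr => /andP[_ gt0].
  by rewrite nmulr_rlt0 // subr_gt0.
Qed.

(** The homogenised value is one integer that is read twice in [real_field_prime_sum2sq]: in Q,
    where it gives a sign, and in F_p, where it gives a root. *)
Lemma horner_homogeneous (K : fieldType) (f : {rmorphism int -> K}) (h : {poly int}) (a b : int) r :
  (size h <= r.+1)%N -> f b != 0 ->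
  f (\sum_(i < r.+1) h`_i * a ^+ i * b ^+ (r - i)) =
  f b ^+ r * (map_poly f h).[f a / f b].
Proof.
move=> hr b0; rewrite (horner_coef_wide (n := r.+1)); last first.
  by apply: leq_trans hr; exact: size_poly.
rewrite rmorph_sum mulr_sumr; apply: eq_bigr => i _ /=.
rewrite coef_map !rmorphM !rmorphXn /= expr_div_n.
have ri : (i <= r)%N by rewrite -ltnS.
rewrite (_ : f b ^+ r = f b ^+ (r - i) * f b ^+ i); last by rewrite -exprD subnK.
by field; rewrite expf_neq0.
Qed.

Lemma expr_int_mod1 (M c : int) n : exists d, (1 + M * c) ^+ n = 1 + M * d.
Proof.
elim: n => [|n [d IH]]; first by exists 0; rewrite expr0 mulr0 addr0.
by exists (c + d + M * c * d); rewrite exprS IH; ring.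
Qed.

(* The minimal polynomial h of theta changes sign at theta, so it takes a negative
   value at some a/b with b highly divisible and a = 1 modulo 4. Up to a
   harmless constant the numerator of h(a/b) is then negative and 1 modulo 4, so it
   has a prime factor p = 3 modulo 4, modulo which h has a simple root. By Hensel's lemma Q(theta)
   embeds in Q_p, where p is not a sum of two squares. *)
Lemma real_field_prime_sum2sq (theta : algC) : theta \is Num.real ->
  exists p, [/\ prime p, (p %% 4 = 3)%N & forall X Y : {poly rat},
    (map_poly QtoC X).[theta] ^+ 2 + (map_poly QtoC Y).[theta] ^+ 2 != p%:R].
Proof.
move=> thR; have [h [_ hmon] hP] := minCpolyP theta.
have h0 : h != 0 by exact: monic_neq0.
have hth : root (map_poly QtoC h) theta by rewrite hP.
have hs : (1 < size h)%N.
  rewrite ltnNge; apply/negP => /size1_polyC E; move: hth h0.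
  by rewrite E map_polyC rootC fmorph_eq0 polyC_eq0 => ->.
have dh0 : h^`() != 0.
  apply/eqP => /(congr1 (fun q : {poly rat} => q`_(size h).-2)) /=.
  rewrite coef_deriv coef0 (_ : (size h).-2.+1 = (size h).-1); last by lia.
  rewrite -/(lead_coef h) (monicP hmon) => /eqP.
  by rewrite pnatr_eq0; lia.
have cop : coprimep h h^`().
  apply/negPn/negP => ncop; have := dvdp_gcdl h h^`(); have := dvdp_gcdr h h^`().
  set g := gcdp _ _; move=> gd /dvdpP[r E].
  have r0 : r != 0 by apply: contra_neq h0 => r0; rewrite E r0 mul0r.
  have := hth; rewrite {1}E rmorphM rootM !hP => /orP[hr|hg].
    have g0 : g != 0 by apply: contra_neq h0 => g0; rewrite E g0 mulr0.
    have := dvdp_leq r0 hr; rewrite {1}E size_mul //.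
    move: ncop g0; rewrite /coprimep -/g -size_poly_gt0.
    by case: (size g) => [|[|m]] // _ _; rewrite !addnS /= ltnNge leq_addr.
  have := dvdp_leq dh0 (dvdp_trans hg gd); rewrite leqNgt lt_size_deriv //.
have dth0 : (map_poly QtoC h)^`().[theta] != 0.
  rewrite deriv_map -rootE hP gtNdvdp // lt_size_deriv //.
have /Bezout_eq1_coprimepP[[u v] /= uv] := cop.
have [h1 [D D0 hE]] := rat_poly_scale h.
have [U [a a0 uE]] := rat_poly_scale u.
have [V [b b0 vE]] := rat_poly_scale v.
have nz (z : int) : z != 0 -> (z%:~R : rat) != 0 by rewrite intr_eq0.
have h1E : map_poly intr h1 = D%:~R *: h by rewrite hE scalerA divff ?scale1r ?nz.
have U1E : map_poly intr U = a%:~R *: u by rewrite uE scalerA divff ?scale1r ?nz.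
have V1E : map_poly intr V = b%:~R *: v by rewrite vE scalerA divff ?scale1r ?nz.
(* Hence a prime dividing both h1(t) and h1'(t) at some integer t divides a b D. *)
have bez : b%:P * U * h1 + a%:P * V * h1^`() = (a * b * D)%:P.
  apply: (map_inj_poly (f := intr : int -> rat)) => //; first exact: intr_inj.
  rewrite !(rmorphD, rmorphM) /= -deriv_map !map_polyC /= h1E U1E V1E.
  rewrite derivZ -!mul_polyC ?rmorphM /=.
  transitivity (a%:~R%:P * b%:~R%:P * D%:~R%:P * (u * h + v * h^`()) : {poly rat}); first by ring.
  by rewrite uv mulr1.
(* The factor 4 serves the residue modulo 4 and the square makes M positive. A prime factor of a
   number 1 + M G does not divide M, so h1 has only simple roots modulo it. *)
pose M : int := 4 * (a * b * D) ^+ 2.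
have abD : a * b * D != 0 by rewrite !mulf_neq0.
have M1 : 1 < M.
  have : 0 < (a * b * D) ^+ 2 by rewrite exprn_even_gt0.
  by rewrite /M; lia.
have [c [K neg]] := simple_root_neg thR hth dth0 M1.
pose al := 1 + M * c; pose be := M ^+ K.+2; pose r := (size h).-1.
have sh1 : size h1 = r.+1.
  have : size (map_poly (intr : int -> rat) h1) = size h by rewrite h1E size_scale ?nz.
  by rewrite size_map_inj_poly //; [move=> ->; rewrite /r prednK // size_poly_gt0|exact: intr_inj].
have lh1 : h1`_r = D.
  have := congr1 (fun q : {poly rat} => q`_r) h1E.
  rewrite /= coef_map coefZ -/(lead_coef h) (monicP hmon) mulr1 => /eqP.
  by rewrite eqr_int => /eqP.
pose H := \sum_(i < r.+1) h1`_i * al ^+ i * be ^+ (r - i).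
have be0 : be != 0 by rewrite expf_neq0 // gt_eqF // (lt_trans _ M1).
have HE : (H%:~R : rat) = D%:~R * (be%:~R ^+ r * h.[al%:~R / be%:~R]).
  have := @horner_homogeneous _ (intr : {rmorphism int -> rat}) h1 al be r.
  by rewrite sh1 => /(_ (leqnn _) (nz _ be0)) ->; rewrite h1E hornerZ mulrCA.
(* Modulo D M only the leading term D al^r survives, because D M divides be, and al is 1 modulo M.
   Dividing by D also removes its unknown sign. *)
have [G GE] : exists G, H = D * (1 + M * G).
  have [d dE] := expr_int_mod1 M c r.
  have [e eE] : exists e, \sum_(i < r) h1`_i * al ^+ i * be ^+ (r - i) = D * (M * e).
    have sum_dvd : forall i : 'I_r, (D * M %| h1`_i * al ^+ i * be ^+ (r - i))%Z.
      move=> i; apply: dvdz_mull; have -> : (r - i = (r - i.+1).+1)%N by have := ltn_ord i; lia.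
      rewrite exprS; apply: dvdz_mulr; rewrite /be exprSr; apply: dvdz_mul; last exact: dvdzz.
      by rewrite exprS; apply: dvdz_mulr; apply/dvdzP; exists (4 * (a * b) ^+ 2 * D); rewrite /M; ring.
    have : (D * M %| \sum_(i < r) h1`_i * al ^+ i * be ^+ (r - i))%Z.
      by apply: rpred_sum => i _; exact: sum_dvd.
    by move=> /dvdzP[e ->]; exists e; ring.
  exists (d + e); rewrite /H big_ord_recr /= eE lh1 subnn expr0 mulr1 /al dE; ring.
have Gneg : 1 + M * G < 0.
  have : ((1 + M * G)%:~R : rat) = be%:~R ^+ r * h.[al%:~R / be%:~R].
    by apply: (mulfI (nz _ D0)); rewrite -HE GE rmorphM.
  rewrite -(ltrz0 rat) => ->; rewrite pmulr_rlt0 // exprn_gt0 // ltr0z exprn_gt0 //.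
  by rewrite (lt_trans _ M1).
have G3 : (`|(1 + M * G)%R| %% 4 = 3)%N.
  have : exists m : int, 1 + M * G = 1 + 4 * m.
    by exists ((a * b * D) ^+ 2 * G); rewrite /M; ring.
  by move=> [m mE]; move: Gneg; rewrite mE; lia.
have [p [pr p3 pG]] := prime_3mod4 G3.
have pM : ~~ (p %| M)%Z.
  apply/negP => pM; have : (p %| 1 + M * G - M * G)%Z.
    by apply: rpredB; [rewrite dvdzE|rewrite dvdz_mulr].
  rewrite addrK dvdzE /= dvdn1 => /eqP p1; by rewrite p1 in pr.
have bp : (be%:~R : 'F_p) != 0.
  by rewrite /be rmorphXn expf_neq0 // -dvdz_Fp.
pose w : 'F_p := al%:~R / be%:~R; pose t0 : int := (w : nat)%:Z.
have t0E : t0%:~R = w :> 'F_p by rewrite -[LHS]/((w : nat)%:R : 'F_p) natr_Zp.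
have ht0 : (p %| h1.[t0])%Z.
  have := @horner_homogeneous _ (intr : {rmorphism int -> 'F_p}) h1 al be r.
  rewrite sh1 => /(_ (leqnn _) bp); rewrite -/H GE -/w -t0E horner_map /=.
  rewrite (_ : _%:~R = 0); last by apply/eqP; rewrite -dvdz_Fp // dvdz_mull // dvdzE.
  by move=> /esym/eqP; rewrite mulf_eq0 expf_eq0 (negPf bp) andbF /= -dvdz_Fp.
have dt0 : ~~ (p %| h1^`().[t0])%Z.
  apply: contra pM => pd; rewrite /M; apply: dvdz_mull; rewrite expr2; apply: dvdz_mulr.
  have := congr1 (fun q : {poly int} => q.[t0]) bez; rewrite /= hornerC => <-.
  by rewrite hornerD !hornerM; apply: rpredD; rewrite dvdz_mull.
exists p; split=> // X Y; apply/eqP => XY.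
have : root (map_poly QtoC (X ^+ 2 + Y ^+ 2 - p%:R%:P)) theta.
  rewrite rmorphB rmorphD !rmorphXn /= map_polyC /= rmorph_nat.
  by rewrite rootE !hornerE XY subrr.
rewrite hP => /dvdpP[Q QE].
apply: (@sum2sq_poly_rat p h1 X Y (D%:~R^-1 *: Q) t0) => //.
rewrite h1E -scalerAl -scalerAr scalerA divff ?scale1r ?nz // mulrC -QE.
by ring.
Qed.

(** * Commuting similitudes *)

(** A finite list of members whose span has maximal rank suffices, because the matrices having v as
    an eigenvector form a linear space. *)
Lemma common_eigenvector_family (C : numClosedFieldType) n (I : choiceType)
    (P : pred I) (B : I -> 'M[C]_n) : (n > 0)%N ->
  (forall i j, P i -> P j -> B i *m B j = B j *m B i) ->
  exists2 v : 'rV_n, v != 0 & forall i, P i -> exists c, v *m B i = c *: v.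
Proof.
move=> n0 comB.
pose S s := foldr (fun i M => (<<mxvec (B i)>> + M)%MS) (0 : 'M_(n * n)) s.
have [s sP smax] : exists2 s, all P s & forall i, P i -> (mxvec (B i) <= S s)%MS.
  have [k] : exists k, (forall s, all P s -> (\rank (S s) <= k)%N) by exists (n * n)%N => s _; exact: rank_leq_row.
  elim: k => [|k IH] bd.
    exists [::] => // i Pi; have := bd [:: i]; rewrite /= Pi => /(_ isT).
    rewrite leqn0 mxrank_eq0 => /eqP E; rewrite -[X in (_ <= X)%MS]E.
    by rewrite (submx_trans _ (addsmxSl _ _)) // genmxE.
  have [[s [sP sr]]|none] := pselect (exists s, all P s /\ \rank (S s) = k.+1).
    exists s => // i Pi; have := bd (i :: s); rewrite /= Pi sP => /(_ isT) le.
    have : (S s <= <<mxvec (B i)>> + S s)%MS by exact: addsmxSr.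
    move/mxrank_leqif_sup => [_ E].
    have : \rank (S s) == \rank (<<mxvec (B i)>> + S s)%MS.
      by rewrite eqn_leq sr le -sr mxrankS ?addsmxSr.
    by rewrite E; apply: submx_trans; rewrite (submx_trans _ (addsmxSl _ _)) // genmxE.
  apply: IH => s sP; have := bd s sP; rewrite leq_eqVlt ltnS => /orP[/eqP sr|//].
  by case: none; exists s.
have [|v v0 /allP/= st] := @common_eigenvector C n (map B s) n0.
  by move=> _ _ /mapP[i si ->] /mapP[j sj ->]; apply: comB; apply: (allP sP).
exists v => // i Pi.
(* The kernel of [L] is this linear space: [L] sends X to v X modulo the line of v. *)
pose L := lin_mulmx v *m lin_mulmxr (cokermx v).
have LE X : mxvec X *m L = mxvec (v *m X *m cokermx v).
  by rewrite mulmxA !mul_vec_lin.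
have SL : (S s <= kermx L)%MS.
  suff H t : all (mem s) t -> (S t <= kermx L)%MS by apply: H; exact/allP.
  elim: t => [|j t IH] /=; first by rewrite sub0mx.
  case/andP=> js /IH tL; rewrite addsmx_sub tL andbT genmxE sub_kermx LE.
  have := st _ (map_f B js); rewrite submxE => /eqP ->.
  by rewrite linear0.
have := submx_trans (smax i Pi) SL; rewrite sub_kermx LE.
rewrite mxvec_eq0 -submxE => /sub_rVP[c E]; by exists c.
Qed.

(* Over algC the A p have a common eigenvector v, with eigenvalues of square norm p.
   When some coordinate of v is 1, the real and imaginary parts of the eigenvalues
   lie in the real number field generated by those of the coordinates of v. *)
Theorem no_commuting_similitudes (m : nat) (d : 'rV[rat]_m) (A : nat -> 'M[rat]_m) :
  (forall i, 0 < d 0 i) ->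
  (forall p q, prime p -> prime q -> A p *m A q = A q *m A p) ->
  (forall p, prime p -> A p *m diag_mx d *m (A p)^T = p%:R *: diag_mx d) ->
  m = 0%N.
Proof.
move=> d0 comA simA; apply/eqP; rewrite -leqn0 leqNgt; apply/negP => m0.
pose B p := map_mx QtoC (A p).
have [v0 v00 v0E] : exists2 v : 'rV_m, v != 0 & forall p, prime p -> exists c, v *m B p = c *: v.
  by apply: common_eigenvector_family => // p q pp pq; rewrite -!map_mxM comA.
have [j vj] : exists j, v0 0 j != 0.
  apply/existsP; apply: contraNT v00 => /existsPn v0j.
  by apply/eqP/rowP => j; rewrite mxE; apply/eqP; have := v0j j; rewrite negbK.
have [v vj1 vE] : exists2 v : 'rV_m, v 0 j = 1 &
    forall p, prime p -> exists c, v *m B p = c *: v.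
  exists ((v0 0 j)^-1 *: v0) => [|p /v0E[c E]]; first by rewrite mxE mulVf.
  by exists c; rewrite -scalemxAl E !scalerA mulrC.
have ceig p c : prime p -> v *m B p = c *: v ->
    'Re c ^+ 2 + 'Im c ^+ 2 = p%:R /\ c = \sum_l v 0 l * QtoC (A p l j).
  move=> pp vc; split; last first.
    have := congr1 (fun u : 'rV_m => u 0 j) vc; rewrite !mxE vj1 mulr1 => <-.
    by apply: eq_bigr => l _; rewrite !mxE.
  rewrite -normC2_Re_Im normCK.
  (* With w the conjugate of v, applying B p to both sides multiplies the Hermitian value v D w^T by
     |c|^2 and by p; the value is nonzero because the diagonal form is positive. *)
  pose w := map_mx (fun x : algC => x^*) v; pose D := map_mx QtoC (diag_mx d).
  have wB : w *m B p = c^* *: w.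
    rewrite -map_mxZ -vc map_mxM; congr (_ *m _).
    by apply/matrixP => a b; rewrite !mxE /= conj_Crat ?Crat_rat.
  have : v *m B p *m D *m (w *m B p)^T = (c * c^*) *: (v *m D *m w^T).
    by rewrite vc wB linearZ /= -!scalemxAl -scalemxAr scalerA.
  have -> : v *m B p *m D *m (w *m B p)^T = p%:R *: (v *m D *m w^T).
    transitivity (v *m (B p *m D *m (B p)^T) *m w^T); first by rewrite trmx_mul !mulmxA.
    have -> : B p *m D *m (B p)^T = p%:R *: D.
      by rewrite /B matrix.map_trmx -!map_mxM simA // map_mxZ rmorph_nat.
    by rewrite -scalemxAr -scalemxAl.
  have sne : (v *m D *m w^T) 0 0 != 0.
    rewrite /D map_diag_mx mul_mx_diag mxE; under eq_bigr do rewrite !mxE.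
    have pos l : 0 <= v 0 l * QtoC (d 0 l) * (v 0 l)^*.
      by rewrite mulrAC -normCK mulr_ge0 ?exprn_ge0 // ler0q ltW.
    rewrite psumr_neq0 //; apply/hasP; exists j; rewrite ?mem_index_enum //=.
    by rewrite vj1 rmorph1 mulr1 mul1r ltr0q.
  by move=> /(congr1 (fun M : 'M_1 => M 0 0)); rewrite [LHS]mxE [RHS]mxE => /(mulIf sne) ->.
pose sR := [seq 'Re (v 0 l) | l : 'I_m]; pose sI := [seq 'Im (v 0 l) | l : 'I_m].
(* A primitive element for all the real and imaginary parts; being an integral combination of them,
   it is real. *)
have [z [a zE] [ps psE]] := algC_PET (sR ++ sI).
have zR : z \is Num.real.
  rewrite zE rpred_sum // => i _; rewrite rpredMn //.
  have : (sR ++ sI)`_i \in sR ++ sI by rewrite mem_nth.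
  by rewrite mem_cat => /orP[] /mapP[l _ ->]; rewrite ?Creal_Re ?Creal_Im.
have inz x : x \in sR ++ sI -> exists P : {poly rat}, x = (map_poly QtoC P).[z].
  by rewrite psE => /mapP[P _ ->]; exists P.
have /boolp.choice[PR PRE] : forall l : 'I_m, exists P : {poly rat}, 'Re (v 0 l) = (map_poly QtoC P).[z].
  move=> l.
  apply: inz.
  by rewrite mem_cat; apply/orP; left; apply: map_f; rewrite mem_enum.
have /boolp.choice[PI PIE] : forall l : 'I_m, exists P : {poly rat}, 'Im (v 0 l) = (map_poly QtoC P).[z].
  move=> l.
  apply: inz.
  by rewrite mem_cat; apply/orP; right; apply: map_f; rewrite mem_enum.
have [p [pp _ noXY]] := real_field_prime_sum2sq zR.
have [c vc] := vE p pp; have [cp cE] := ceig p c pp vc.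
pose X := \sum_l A p l j *: PR l; pose Y := \sum_l A p l j *: PI l.
have := noXY X Y; rewrite (_ : (map_poly QtoC X).[z] = 'Re c); last first.
  rewrite cE [RHS]raddf_sum /X [map_poly _ _]raddf_sum horner_sum; apply: eq_bigr => l _ /=.
  by rewrite map_polyZ hornerZ -PRE mulrC ReMr ?Creal_Crat ?Crat_rat.
rewrite (_ : (map_poly QtoC Y).[z] = 'Im c) ?cp ?eqxx //.
rewrite cE [RHS]raddf_sum /Y [map_poly _ _]raddf_sum horner_sum; apply: eq_bigr => l _ /=.
by rewrite map_polyZ hornerZ -PIE mulrC ImMr ?Creal_Crat ?Crat_rat.
Qed.

Section Similitudes.
Variables (W : lmodType rat) (b : W -> W -> rat).
Hypotheses (bsym : forall v w, b v w = b w v)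
  (blin : forall w, linear (b^~ w : W -> rat^o))
  (bpos : forall w, w != 0 -> 0 < b w w).

Let form_l w : {linear W -> rat^o} :=
  HB.pack (b^~ w : W -> rat^o) (GRing.isLinear.Build rat W rat^o _ _ (blin w)).

Lemma form_suml (I : Type) (r : seq I) (c : I -> rat) (f : I -> W) w :
  b (\sum_(i <- r) c i *: f i) w = \sum_(i <- r) c i * b (f i) w.
Proof.
rewrite -[LHS]/(form_l w _) linear_sum; apply: eq_bigr => i _.
by rewrite linearZ.
Qed.

Lemma form_B u v w : b (u - v) w = b u w - b v w.
Proof. exact: (linearB (form_l w)). Qed.

Lemma form_D u v w : b (u + v) w = b u w + b v w.
Proof. exact: (linearD (form_l w)). Qed.

Lemma form_Z a v w : b (a *: v) w = a * b v w.
Proof. by rewrite -[LHS]/(form_l w _) linearZ. Qed.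

Definition orthogonal_proj (fs : seq W) w := \sum_(f <- fs) (b w f / b f f) *: f.

Lemma orthogonal_projE (fs : seq W) f w : uniq fs -> 0 \notin fs ->
  (forall g h, g \in fs -> h \in fs -> g != h -> b g h = 0) -> f \in fs ->
  b (orthogonal_proj fs w) f = b w f.
Proof.
move=> us f0 orth ff; rewrite form_suml (bigD1_seq f) //= big_seq_cond big1 ?addr0.
  have /bpos/lt0r_neq0 bf : f != 0 by apply: contraNneq f0 => <-.
  by rewrite divfK.
by move=> g /andP[gf ngf]; rewrite (orth g f) // mulr0.
Qed.

(** Gram-Schmidt without normalisation, as square roots leave [rat]. A remainder e' equal to 0 means
    that e adds nothing to the span. *)
Lemma orthogonal_basis (es : seq W) : exists fs : seq W, [/\ uniq fs, 0 \notin fs,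
  forall g h, g \in fs -> h \in fs -> g != h -> b g h = 0 &
  forall e, e \in es -> e = orthogonal_proj fs e].
Proof.
elim: es => [|e es [fs [us f0 orth span]]]; first by exists [::]; split.
pose e' := e - orthogonal_proj fs e.
have e'f f : f \in fs -> b e' f = 0.
  by move=> ff; rewrite form_B orthogonal_projE // subrr.
have e'proj x : b (orthogonal_proj fs x) e' = 0.
  rewrite form_suml big_seq big1 // => f ff; rewrite (bsym f e') e'f //.
  by rewrite mulr0.
have [e'0|e'0] := eqVneq e' 0.
  exists fs; split=> // x; rewrite inE => /orP[/eqP->|/span//].
  by apply/eqP; rewrite -subr_eq0 -/e' e'0.
have e'nf : e' \notin fs.
  by apply: contraNN e'0 => /e'f E; apply: contraT => /bpos; rewrite E ltxx.
exists (e' :: fs); split.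
- by rewrite /= e'nf.
- by rewrite inE negb_or eq_sym e'0.
- move=> g h; rewrite !inE => /orP[/eqP->|gf] /orP[/eqP->|hf] //.
  + by rewrite eqxx.
  + by rewrite e'f.
  + by rewrite bsym e'f.
  + exact: orth.
- move=> x; rewrite inE => /orP[/eqP->|/[dup] xes /span xE]; rewrite /orthogonal_proj big_cons.
    have -> : b e e' = b e' e'.
      by rewrite -[in LHS](subrK (orthogonal_proj fs e) e) -/e' form_D e'proj addr0.
    by rewrite divff ?scale1r ?subrK // lt0r_neq0 // bpos.
  by rewrite {2}xE e'proj mul0r scale0r add0r.
Qed.

Theorem no_similitude_family (T : nat -> {linear W -> W}) : fin_dim [set: W] ->
  (forall p q w, prime p -> prime q -> T p (T q w) = T q (T p w)) ->
  (forall p v w, prime p -> b (T p v) (T p w) = p%:R * b v w) ->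
  forall w : W, w = 0.
Proof.
move=> [m [e [_ espan]]] comT simT.
have [fs [us f0 orth span]] := orthogonal_basis [seq e i | i : 'I_m].
have projlin : linear (orthogonal_proj fs).
  move=> a u v; rewrite /orthogonal_proj scaler_sumr -big_split; apply: eq_bigr => f _ /=.
  by rewrite form_D form_Z scalerA -scalerDl mulrDl mulrA.
have spanW w : w = orthogonal_proj fs w.
  have [c ->] := espan w I.
  pose pr := GRing.isLinear.Build rat W W _ (orthogonal_proj fs) projlin.
  pose prl : {linear W -> W} := HB.pack (orthogonal_proj fs) pr.
  rewrite -[RHS]/(prl _) linear_sum; apply: eq_bigr => i _; rewrite linearZ /=.
  by congr (_ *: _); apply: span; apply: map_f; rewrite mem_enum.
pose r := size fs; pose f (i : 'I_r) := fs`_i.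
have ff i : f i \in fs by rewrite mem_nth.
have finj i j : (f i == f j) = (i == j) by rewrite nth_uniq.
pose d := \row_(i < r) b (f i) (f i).
have dpos i : 0 < d 0 i by rewrite mxE bpos //; apply: contraNneq f0 => <-.
have bff i j : b (f i) (f j) = d 0 i *+ (i == j).
  rewrite mxE; have [<-|ij] := eqVneq i j; first by rewrite mulr1n.
  by rewrite mulr0n orth // finj.
have exp w : w = \sum_i (b w (f i) / d 0 i) *: f i.
  rewrite {1}[w]spanW /orthogonal_proj (big_nth 0) big_mkord.
  by apply: eq_bigr => i _; rewrite mxE.
pose A p := \matrix_(i < r, j < r) (b (T p (f i)) (f j) / d 0 j).
have AE p i : T p (f i) = \sum_j A p i j *: f j.
  by rewrite {1}[T p _]exp; apply: eq_bigr => j _; rewrite [A p i j]mxE.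
have AM p q i l : (A p *m A q) i l = b (T q (T p (f i))) (f l) / d 0 l.
  rewrite mxE AE linear_sum; under [in RHS]eq_bigr do rewrite linearZ /=.
  rewrite form_suml mulr_suml; apply: eq_bigr => j _.
  by rewrite [A q _ _]mxE mulrA.
have comA p q : prime p -> prime q -> A p *m A q = A q *m A p.
  by move=> pp pq; apply/matrixP => i l; rewrite !AM comT.
have simA p : prime p -> A p *m diag_mx d *m (A p)^T = p%:R *: diag_mx d.
  move=> pp; apply/matrixP => i l; rewrite mul_mx_diag mxE [RHS]mxE [diag_mx _ _ _]mxE.
  rewrite -bff -simT // AE form_suml; apply: eq_bigr => j _.
  rewrite [in LHS]mxE [(A p)^T _ _]mxE [A p l j]mxE -mulrA; congr (_ * _).
  by rewrite mulrC divfK ?lt0r_neq0 // bsym.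
have r0 := no_commuting_similitudes dpos comA simA.
by move=> w; rewrite [w]exp big1 // => i _; case: i => i ir; exfalso; move: ir; rewrite r0.
Qed.
End Similitudes.

(** * Extension of partial isomorphisms *)

Section PartialIso.
Variables (k F : fieldType) (iota : {rmorphism k -> F}).

(* The graphs of the k-isomorphisms between subfields of F. *)
Definition partial_iso (R : set (F * F)) :=
  [/\ forall c, R (iota c, iota c), GRing.divring_closed [in R]
    & forall a, R a -> (a.1 == 0) = (a.2 == 0)].

Section SubField.
Variables (R : set (F * F)) (pR : partial_iso R).

Fact piso_divring : GRing.divring_closed [in R]. Proof. by case: pR. Qed.
Definition piso_pred of partial_iso R : {pred F * F} := [in R].
Local Notation predR := (piso_pred pR).
HB.instance Definition _ :=
  GRing.isDivringClosed.Build (F * F)%type predR piso_divring.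

(** The graph is itself a field, embedded in F by both projections, so that one polynomial over it
    encodes a pair of corresponding polynomials. *)
Definition piso := {a : F * F | a \in predR}.
HB.instance Definition _ := SubType.on piso.
HB.instance Definition _ := Choice.on piso.
HB.instance Definition _ := [SubChoice_isSubComUnitRing of piso by <:].

Lemma piso_mem (a : piso) : R (val a). Proof. exact/set_mem/(valP a). Qed.

Lemma piso_fst_eq0 (a : piso) : ((val a).1 == 0) = (a == 0).
Proof.
have [_ _ /(_ _ (piso_mem a)) E] := pR.
rewrite -(inj_eq val_inj) /= -[0 : F * F]/(0, 0) -pair_eqE /pair_eq /= -E.
by rewrite andbb.
Qed.

Fact piso_field : GRing.field_axiom piso.
Proof.
move=> a; rewrite -piso_fst_eq0 => a0; have [_ _ /(_ _ (piso_mem a)) E] := pR.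
change (val a \is a GRing.unit); apply/unitrP; exists ((val a).1^-1, (val a).2^-1).
by split; congr pair; rewrite /= ?mulVf ?divff -?E.
Qed.
HB.instance Definition _ := GRing.ComUnitRing_isField.Build piso piso_field.

Definition piso_fst : piso -> F := fst \o val.
Definition piso_snd : piso -> F := snd \o val.
HB.instance Definition _ := GRing.RMorphism.copy piso_fst (fst \o val).
HB.instance Definition _ := GRing.RMorphism.copy piso_snd (snd \o val).

Local Notation f1 := (piso_fst : {rmorphism piso -> F}).
Local Notation f2 := (piso_snd : {rmorphism piso -> F}).

(** The graph of the extension sending x to y. Values of polynomials suffice, without quotients,
    when x and y are algebraic. *)
Definition piso_ext (x y : F) : set (F * F) :=
  [set ((map_poly f1 P).[x], (map_poly f2 P).[y]) | P in [set: {poly piso}]].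

Lemma piso_ext_sub x y : R `<=` piso_ext x y.
Proof.
move=> a Ra; exists (Sub a (mem_set Ra))%:P => //.
by rewrite !map_polyC !hornerC /=; case: a Ra.
Qed.

Lemma piso_ext_mem x y : piso_ext x y (x, y).
Proof. by exists 'X; rewrite // !map_polyX !hornerX. Qed.

(** With a common minimal polynomial p, the values of P at x and y vanish together; inverses come
    from a Bezout relation with p. *)
Lemma piso_extP (x y : F) (p : {poly piso}) :
  (forall P, root (map_poly f1 P) x = (p %| P)) ->
  (forall P, root (map_poly f2 P) y = (p %| P)) -> irreducible_poly p ->
  partial_iso (piso_ext x y).
Proof.
move=> p1 p2 irp; split=> [c||].
- by apply: piso_ext_sub; have [] := pR.
- split; first by apply/mem_set; exists 1; rewrite // !rmorph1 !hornerC.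
  move=> _ _ /set_mem[P _ <-] /set_mem[Q _ <-]; apply/mem_set.
    by exists (P - Q); rewrite // !rmorphB !hornerE.
  move=> _ _ /set_mem[P _ <-] /set_mem[Q _ <-]; apply/mem_set.
  have [pQ|pQ] := boolP (p %| Q).
    have := pQ; rewrite -p1 => /rootP ->; have := pQ; rewrite -p2 => /rootP ->.
    exists 0 => //; rewrite !rmorph0 !horner0.
    by rewrite (_ : (0, 0) = 0 :> F * F)// invr0 mulr0.
  have /Bezout_eq1_coprimepP[[u v] /= E] : coprimep p Q.
    rewrite /coprimep; apply: contraNT pQ => /irp/(_ (dvdp_gcdl _ _)) pE.
    by rewrite -(eqp_dvdl _ pE) dvdp_gcdr.
  exists (P * v) => //.
  have E1 : (map_poly f1 v).[x] * (map_poly f1 Q).[x] = 1.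
    have := congr1 (fun p => (map_poly f1 p).[x]) E.
    rewrite /= !(rmorphD, rmorphM, rmorph1) /= hornerD !hornerM hornerC => <-.
    by rewrite (rootP (_ : root (map_poly f1 p) x)) ?p1 // mulr0 add0r.
  have E2 : (map_poly f2 v).[y] * (map_poly f2 Q).[y] = 1.
    have := congr1 (fun p => (map_poly f2 p).[y]) E.
    rewrite /= !(rmorphD, rmorphM, rmorph1) /= hornerD !hornerM hornerC => <-.
    by rewrite (rootP (_ : root (map_poly f2 p) y)) ?p2 // mulr0 add0r.
  set q := (X in _ = _ / X); set a := (X in _ = X / _).
  pose b : F * F := ((map_poly f1 v).[x], (map_poly f2 v).[y]).
  have bq : b * q = 1 by congr pair.
  have uq : q \is a GRing.unit by apply/unitrP; exists b; rewrite bq mulrC.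
  transitivity (a * b); first by rewrite !rmorphM !hornerM.
  by congr (_ * _); rewrite -[LHS](mulrK uq) bq mul1r.
- by move=> _ [P _ <-] /=; rewrite -[LHS]/(root _ _) p1 -p2.
Qed.
End SubField.
End PartialIso.

Arguments piso_fst {k F iota R} pR _.
Arguments piso_snd {k F iota R} pR _.
Arguments piso_ext {k F iota R} pR _ _.

Section Extension.
Variables (k : fieldType) (F : closedFieldType) (iota : {rmorphism k -> F}).
Implicit Type R : set (F * F).

Lemma minpoly_exists (K : fieldType) (f : {rmorphism K -> F}) (x : F) :
  (exists2 p : {poly K}, p != 0 & root (map_poly f p) x) ->
  exists2 p : {poly K}, irreducible_poly p &
    forall P, root (map_poly f P) x = (p %| P).
Proof.
move=> [p0 p00 p0x].
pose ex n := `[< exists p : {poly K}, [/\ p != 0, root (map_poly f p) x & size p = n] >].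
have exn : exists n, ex n by exists (size p0); apply/asboolP; exists p0.
case: (ex_minnP exn) => n /asboolP[p [pn0 px ps]] nmin.
have pmin q : root (map_poly f q) x -> (size q < size p)%N -> q = 0.
  move=> qx; apply: contraTeq => q0; rewrite -leqNgt ps; apply: nmin.
  by apply/asboolP; exists q.
have dvd P : root (map_poly f P) x = (p %| P).
  apply/idP/idP => [Px|/dvdpP[q ->]]; last by rewrite rmorphM rootM px orbT.
  rewrite /dvdp; apply/eqP/pmin; last by rewrite ltn_modp.
  move: Px; rewrite {1}(divp_eq P p) rmorphD rmorphM /= !rootE hornerD hornerM.
  by rewrite (rootP px) mulr0 add0r.
exists p => //; split.
  rewrite ltnNge; apply/negP => /size1_polyC E; move: px pn0.
  by rewrite E map_polyC rootC fmorph_eq0 polyC_eq0 => ->.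
move=> q q1 /dvdpP[r E]; have := px; rewrite E rmorphM rootM !dvd => /orP[pr|pq].
  have r0 : r != 0 by apply: contra_neq pn0 => r0; rewrite E r0 mul0r.
  have q0 : q != 0 by apply: contra_neq pn0 => q0; rewrite E q0 mulr0.
  have := dvdp_leq r0 pr; rewrite E size_mul //.
  by move: q1 q0; rewrite -size_poly_gt0; lia.
by rewrite -E /eqp pq andbT E dvdp_mull.
Qed.

Lemma piso_dom_divring R : partial_iso iota R ->
  GRing.divring_closed [in [set a.1 | a in R]].
Proof.
move=> pR; pose f : {rmorphism piso pR -> F} := piso_fst pR.
have lift x : [set a.1 | a in R] x -> exists a : piso pR, f a = x.
  by move=> [a Ra <-]; exists (Sub a (mem_set Ra)).
have fP (a : piso pR) : [set a.1 | a in R] (f a).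
  by exists (val a) => //; exact: piso_mem.
split; first by apply/mem_set; rewrite -(rmorph1 f); exact: fP.
- move=> x y /set_mem/lift[a <-] /set_mem/lift[b <-].
  by apply/mem_set; rewrite -rmorphB; exact: fP.
- move=> x y /set_mem/lift[a <-] /set_mem/lift[b <-].
  by apply/mem_set; rewrite -fmorph_div; exact: fP.
Qed.

Lemma piso_lift_poly R (pR : partial_iso iota R) (p : {poly F}) :
  (forall i, [set a.1 | a in R] p`_i) ->
  exists q : {poly piso pR}, map_poly (piso_fst pR : {rmorphism _ -> _}) q = p.
Proof.
move=> pK; have /choice[c cP] i : exists b : piso pR, (val b).1 = p`_i.
  by have [a Ra <-] := pK i; exists (Sub a (mem_set Ra)).
exists (\poly_(i < size p) c i); apply/polyP => i.
rewrite coef_map coef_poly; case: ltnP => [_|pi]; first exact: cP.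
by rewrite nth_default.
Qed.

Lemma piso_adjoin R x : partial_iso iota R ->
  algebraic_over [set a.1 | a in R] x ->
  exists y R', [/\ partial_iso iota R', R `<=` R' & R' (x, y)].
Proof.
move=> pR [p0 [p00 p0R p0x]]; have [q0 q0E] := piso_lift_poly pR p0R.
have [p irp p1] : exists2 p : {poly piso pR}, irreducible_poly p &
    forall P, root (map_poly (piso_fst pR : {rmorphism _ -> _}) P) x = (p %| P).
  apply: minpoly_exists; exists q0; last by rewrite q0E.
  by apply: contra_neq p00 => q00; rewrite -q0E q00 rmorph0.
have /closed_rootP[y py] : size (map_poly (piso_snd pR : {rmorphism _ -> _}) p) != 1.
  by rewrite size_map_poly gtn_eqF //; case: irp.
exists y, (piso_ext pR x y); split; last exact: piso_ext_mem.
  apply: (@piso_extP _ _ _ _ _ _ _ p) => // P; apply/idP/idP => [Py|/dvdpP[q ->]].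
    apply: contraT => pP; have : coprimep p P.
      rewrite /coprimep; apply: contraNT pP => /irp/(_ (dvdp_gcdl _ _)) pE.
      by rewrite -(eqp_dvdl _ pE) dvdp_gcdr.
    move=> /Bezout_eq1_coprimepP[[u v] /= E].
    have := congr1 (fun p => (map_poly (piso_snd pR : {rmorphism _ -> _}) p).[y]) E.
    rewrite /= !(rmorphD, rmorphM, rmorph1) /= hornerD !hornerM hornerC.
    by rewrite (rootP py) (rootP Py) !mulr0 addr0 => /esym/eqP; rewrite oner_eq0.
  by rewrite rmorphM rootM py orbT.
exact: piso_ext_sub.
Qed.

Lemma piso_swap R : partial_iso iota R ->
  partial_iso iota [set a | R (a.2, a.1)].
Proof.
case=> [Rk [R1 RB RV] R0]; split=> [c|| a /R0/= ->] //; first exact: Rk.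
split; first by apply/mem_set; exact: (set_mem R1).
- move=> a b /set_mem/= /mem_set Ra /set_mem/= /mem_set Rb; apply/mem_set => /=.
  exact: (set_mem (RB _ _ Ra Rb)).
- move=> a b /set_mem/= /mem_set Ra /set_mem/= Rb; apply/mem_set => /=.
  have := set_mem (RV _ _ Ra (mem_set Rb)); congr R.
  have [b0|b0] := eqVneq b.1 0.
    have b20 : b.2 = 0 by apply/eqP; have := R0 _ Rb; rewrite /= b0 eqxx => ->.
    have -> : (b.2, b.1) = 0 :> F * F by rewrite b0 b20.
    have -> : b = 0 by case: b {Rb} b0 b20 => b1 b2 /= -> ->.
    by rewrite !invr0 !mulr0.
  have b20 : b.2 != 0 by have := R0 _ Rb => /= ->.
  have ub : b \is a GRing.unit.
    by apply/unitrP; exists (b.1^-1, b.2^-1); split; congr pair; rewrite /= ?mulVf ?divff.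
  have ub' : (b.2, b.1) \is a @GRing.unit (F * F)%type.
    by apply/unitrP; exists (b.2^-1, b.1^-1); split; congr pair; rewrite /= ?mulVf ?divff.
  have -> : b^-1 = (b.1^-1, b.2^-1).
    by apply: (mulrI ub); rewrite mulrV //; congr pair; rewrite /= ?divff.
  have -> // : (b.2, b.1)^-1 = (b.2^-1, b.1^-1).
  by apply: (mulrI ub'); rewrite mulrV //; congr pair; rewrite /= ?divff.
Qed.

Lemma piso_fun R x y y' : partial_iso iota R -> R (x, y) -> R (x, y') -> y = y'.
Proof.
case=> _ [_ RB _] R0 Ry Ry'; have /set_mem Rs := RB _ _ (mem_set Ry) (mem_set Ry').
by apply/eqP; have := R0 _ Rs; rewrite /= subrr eqxx subr_eq0 => <-.
Qed.

Lemma piso_maximal R0 : partial_iso iota R0 ->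
  exists R, [/\ partial_iso iota R, R0 `<=` R &
    forall R', partial_iso iota R' -> R `<=` R' -> R' `<=` R].
Proof.
(* Stating the property for the union with [R0] makes it hold for the empty chain, whose union is
   empty. *)
move=> pR0; pose P X := partial_iso iota (R0 `|` X).
have chainP C : C `<=` P -> total_on C subset -> P (\bigcup_(X in C) X).
{
  move=> CP totC; set U := \bigcup_(X in C) X.
  have big1 a : (R0 `|` U) a -> exists X, [/\ partial_iso iota (R0 `|` X),
      X `<=` U, (X = set0 \/ C X) & (R0 `|` X) a].
    case=> [R0a|[X CX Xa]]; first by exists set0; rewrite setU0; split=> //; left.
    exists X; split; [exact: CP|by move=> ? ?; exists X|by right|by right].
  have big2 a b : (R0 `|` U) a -> (R0 `|` U) b -> exists X,
      [/\ partial_iso iota (R0 `|` X), X `<=` U, (R0 `|` X) a & (R0 `|` X) b].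
    move=> /big1[X [pX XU CX Xa]] /big1[Y [pY YU CY Yb]].
    have [XY|YX] : X `<=` Y \/ Y `<=` X.
      by case: CX CY => [->|CX] [->|CY]; [left|left|right|exact: totC].
      by exists Y; split=> //; apply: setUS Xa.
    by exists X; split=> //; apply: setUS Yb.
  split=> [c||a /big1[X [[_ _ X0] _ _ /X0]] //].
  - by left; case: pR0.
  - split; first by apply/mem_set; left; case: pR0 => _ [/set_mem].
    + move=> a b /set_mem Ra /set_mem Rb; have [X [[_ [_ XB _] _] XU Xa Xb]] := big2 _ _ Ra Rb.
      by apply/mem_set; apply: setUS (set_mem (XB _ _ (mem_set Xa) (mem_set Xb))).
    + move=> a b /set_mem Ra /set_mem Rb; have [X [[_ [_ _ XV] _] XU Xa Xb]] := big2 _ _ Ra Rb.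
      by apply/mem_set; apply: setUS (set_mem (XV _ _ (mem_set Xa) (mem_set Xb))).
}
have [A [PA maxA]] := Zorn_bigcup chainP.
exists (R0 `|` A); split=> // R' pR' AR'.
apply: contrapT => R'A.
have AR : A `<=` R' by move=> a Aa; apply: AR'; right.
apply: (maxA R').
  split=> // R'A'; apply: R'A => a /R'A' ?; by right.
rewrite /P (_ : R0 `|` R' = R') //; apply/setUidr => a R0a; by apply: AR'; left.
Qed.

Lemma algebraic_over_sub (K L : set F) x : K `<=` L ->
  algebraic_over K x -> algebraic_over L x.
Proof. by move=> KL [p [p0 pK px]]; exists p; split=> // i; apply: KL. Qed.

(** A maximal extension is defined everywhere, since F is algebraic over its domain; the same
    argument for the inverse graph makes it onto. *)
Lemma piso_extend R0 : partial_iso iota R0 ->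
  (forall x, algebraic_over [set a.1 | a in R0] x) ->
  (forall y, algebraic_over [set a.2 | a in R0] y) ->
  exists g : autOver iota, forall a, R0 a -> g a.1 = a.2.
Proof.
move=> pR0 dom cod; have [R [pR R0R maxR]] := piso_maximal pR0.
have totR x : exists y, R (x, y).
  have [|y [R' [pR' RR' R'xy]]] := @piso_adjoin R x pR.
    by apply: algebraic_over_sub (dom x) => _ [a /R0R Ra <-]; exists a.
  by exists y; apply: maxR R'xy.
have surR y : exists x, R (x, y).
  have [|x [R' [pR' RR' R'xy]]] := @piso_adjoin [set a | R (a.2, a.1)] y (piso_swap pR).
    apply: algebraic_over_sub (cod y) => _ [a /R0R Ra <-]; exists (a.2, a.1) => //=.
    by case: a Ra.
  exists x; apply: (maxR _ (piso_swap pR')); last exact: R'xy.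
  by move=> [a b] Rab; apply: RR'.
have [g gR] := choice totR; have [h hR] := choice surR.
have funR x y : R (x, y) -> y = g x by move=> Rxy; apply: piso_fun pR Rxy (gR x).
have injR x y : R (x, y) -> x = h y.
  by move=> Rxy; apply: (piso_fun (piso_swap pR)) (hR y); exact: Rxy.
have [Rk [R1 RB RV] Rz] := pR.
have gB : zmod_morphism g.
  move=> x y; apply/esym/funR.
  exact: set_mem (RB _ _ (mem_set (gR x)) (mem_set (gR y))).
have g1 : g 1 = 1 by apply/esym/funR/(set_mem R1).
have gM : monoid_morphism g.
  split=> // x y; apply/esym/funR.
  have RM : GRing.mulr_closed [in R].
    exact: GRing.divr_closedM (And3 R1 RB RV : GRing.divring_closed _).
  by case: RM => _ RM; exact: set_mem (RM _ _ (mem_set (gR x)) (mem_set (gR y))).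
have gh : cancel g h by move=> x; apply/esym/injR.
have hg : cancel h g by move=> y; apply/esym/funR.
have gk c : g (iota c) = iota c by apply/esym/funR.
exists (AutOver gB gM gh hg gk) => -[x y] /R0R Rxy /=; exact/esym/funR.
Qed.
End Extension.

(** * The line of Haar measures *)

Lemma card_fset_set_seq (T : choiceType) (S : set T) (s : seq T) :
  uniq s -> (forall x, S x <-> x \in s) -> #|` fset_set S| = size s.
Proof.
move=> us Ss; have -> : S = [set` s] by apply/seteqP; split=> x /Ss.
have fs : finite_set [set` s] by exact: finite_seq.
apply: perm_size; apply: uniq_perm => // x; by rewrite in_fset_set // mem_setE.
Qed.

Section Index.
Variable G : topGroupType.
Implicit Types (A B C U V : set G) (g h : G).

Definition lcosets U V : set (set G) := [set lcoset V g | g in U].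

Lemma subgroup1 U : is_subgroup U -> U 1%g. Proof. by case=> /set_mem. Qed.

Lemma subgroup_div U g h : is_subgroup U -> U g -> U h -> U (g / h)%g.
Proof. by case=> _ UV Ug Uh; apply/set_mem/UV; exact/mem_set. Qed.

Lemma subgroupV U g : is_subgroup U -> U g -> U g^-1%g.
Proof. by move=> sU Ug; rewrite -[g^-1%g]mul1g; apply: subgroup_div => //; exact: subgroup1. Qed.

Lemma subgroupM U g h : is_subgroup U -> U g -> U h -> U (g * h)%g.
Proof. by move=> sU Ug Uh; rewrite -[h]invgK; apply: subgroup_div => //; exact: subgroupV. Qed.

Lemma lcoset_eq V g h : is_subgroup V -> lcoset V g = lcoset V h <-> V (h^-1 * g)%g.
Proof.
move=> sV; split=> [E|Vhg].
  have : lcoset V g g by exists 1%g; [exact: subgroup1|rewrite mulg1].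
  by rewrite E => -[v Vv <-]; rewrite mulKg.
apply/seteqP; split=> _ [v Vv <-].
  by exists (h^-1 * g * v)%g; [exact: subgroupM|rewrite -!mulgA mulVKg].
exists (g^-1 * h * v)%g; last by rewrite -!mulgA mulVKg.
by apply: subgroupM => //; rewrite -[(g^-1 * h)%g]invgK invgM invgK; exact: subgroupV.
Qed.

Lemma index_gt0 U V : is_subgroup U -> finite_set (lcosets U V) -> (0 < Defs.index U V)%N.
Proof.
move=> sU fin; rewrite /Defs.index cardfs_gt0; apply/fset0Pn; exists (lcoset V 1%g).
by rewrite in_fset_set // in_setE; exists 1%g => //; exact: subgroup1.
Qed.

Lemma sub_lcosets A B C : is_subgroup A -> is_subgroup B -> B `<=` A ->
  finite_set (lcosets A C) -> finite_set (lcosets B C).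
Proof. by move=> sA sB BA; apply: sub_finite_set => _ [g Bg <-]; exists g; [exact: BA|]. Qed.

Lemma lcosets_coarse A B C : is_subgroup B -> is_subgroup C -> C `<=` B ->
  finite_set (lcosets A C) -> finite_set (lcosets A B).
Proof.
move=> sB sC CB fin; pose f (X : set G) := [set (x * b)%g | x in X & b in B].
apply: sub_finite_set (finite_image f fin) => _ [g Ag <-].
exists (lcoset C g); first by exists g.
apply/seteqP; split=> [_ [_ [c Cc <-] [b Bb <-]]|_ [b Bb <-]].
  by exists (c * b)%g; [apply: subgroupM => //; exact: CB|rewrite mulgA].
by exists g; [exists 1%g; [exact: subgroup1|rewrite mulg1]|exists b].
Qed.

Lemma index_mul A B C : is_subgroup A -> is_subgroup B -> is_subgroup C ->
  C `<=` B -> B `<=` A -> finite_set (lcosets A C) ->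
  Defs.index A C = (Defs.index A B * Defs.index B C)%N.
Proof.
move=> sA sB sC CB BA finAC.
have finAB := lcosets_coarse sB sC CB finAC.
have finBC := sub_lcosets sA sB BA finAC.
have /choice[r rP] X : exists g, lcosets A B X -> A g /\ lcoset B g = X.
  by have [[g Ag <-]|nX] := pselect (lcosets A B X); [exists g|exists 1%g].
pose f X (Y : set G) := [set (r X * y)%g | y in Y].
have fE X b : f X (lcoset C b) = lcoset C (r X * b)%g.
  apply/seteqP; split=> [_ [_ [c Cc <-] <-]|_ [c Cc <-]].
    by exists c; rewrite // mulgA.
  by exists (b * c)%g; [exists c|rewrite mulgA].
pose s := [seq f X Y | X <- fset_set (lcosets A B), Y <- fset_set (lcosets B C)].
rewrite /Defs.index -(size_allpairs f); apply: (card_fset_set_seq (s := s)).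
  apply: allpairs_uniq => [||[X Y] [X' Y']] /=; rewrite ?fset_uniq //.
  move=> /allpairsP[[X1 Y1] /= [X1s Y1s [-> ->]]] /allpairsP[[X2 Y2] /= [X2s Y2s [-> ->]]].
  move: X1s Y1s X2s Y2s; rewrite !in_fset_set // !in_setE.
  move=> CX1 [b1 Bb1 <-] CX2 [b2 Bb2 <-]; rewrite !fE => /(lcoset_eq _ _ sC) E.
  have [[Ar1 r1] [Ar2 r2]] := (rP _ CX1, rP _ CX2).
  have XE : X1 = X2.
    rewrite -r1 -r2; apply/(lcoset_eq _ _ sB).
    have -> : ((r X2)^-1 * r X1 = b2 * ((r X2 * b2)^-1 * (r X1 * b1)) * b1^-1)%g.
      by rewrite invgM !mulgA mulgV mul1g mulgK.
    apply: subgroupM => //; last exact: subgroupV.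
    by apply: subgroupM => //; exact: CB.
  congr (_, _) => //; apply/(lcoset_eq _ _ sC).
  by move: E; rewrite XE invgM -!mulgA mulKg.
move=> X; split=> [[a Aa <-]|/allpairsP[[X1 Y1] /= [X1s Y1s ->]]].
  have AX : lcosets A B (lcoset B a) by exists a.
  have [Ar rE] := rP _ AX; have Bb := (lcoset_eq _ _ sB).1 (esym rE).
  apply/allpairsP; exists (lcoset B a, lcoset C ((r (lcoset B a))^-1 * a)%g) => /=.
  split; last by rewrite fE mulVKg.
    by rewrite in_fset_set // in_setE.
  by rewrite in_fset_set // in_setE; eexists; first exact: Bb.
move: X1s Y1s; rewrite !in_fset_set // !in_setE => AX1 [b Bb <-].
exists (r X1 * b)%g; last by rewrite fE.
by apply: subgroupM => //; [case: (rP _ AX1)|exact: BA].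
Qed.

Lemma open_subgroup_closed U : is_subgroup U -> open U -> closed U.
Proof.
move=> sU oU; rewrite -[U]setCK; apply: open_closedC.
rewrite (_ : ~` U = \bigcup_(g in ~` U) lcoset U g).
  apply: bigcup_open => g _; rewrite (_ : lcoset U g = (fun x => g^-1 * x)%g @^-1` U).
    by apply: open_comp => // x _; exact: mulg_left_cts.
  apply/seteqP; split=> [_ [u Uu <-]|x /= Ux]; first by rewrite /= mulKg.
  by exists (g^-1 * x)%g => //; rewrite mulVKg.
apply/seteqP; split=> [x Ux|x [g Ug [u Uu <-]] Ugu].
  by exists x => //; exists 1%g; [exact: subgroup1|rewrite mulg1].
by apply: Ug; rewrite -[g](mulgK u); exact: subgroup_div.
Qed.

Definition pointed_group : Type := G.
HB.instance Definition _ := Topological.copy pointed_group G.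
HB.instance Definition _ := isPointed.Build pointed_group (1%g : G).

Lemma compact_cover_group U : compact U -> @cover_compact G U.
Proof. by move=> cU; rewrite -[@cover_compact G]/(@cover_compact pointed_group) -compact_cover. Qed.

Lemma compact_finite_lcosets U V : compact U -> is_subgroup V -> open V ->
  finite_set (lcosets U V).
Proof.
move=> cU sV oV; have lV g : lcoset V g = (fun x => g^-1 * x)%g @^-1` V.
  apply/seteqP; split=> [_ [u Uu <-]|x /= Ux]; first by rewrite /= mulKg.
  by exists (g^-1 * x)%g => //; rewrite mulVKg.
move: (compact_cover_group cU) => /(_ (set G) (lcosets U V) id)[||D DU UD].
  move=> _ [g _ <-]; rewrite lV; apply: open_comp => // x _; exact: mulg_left_cts.
  move=> x Ux; exists (lcoset V x); first by exists x.
    by exists 1%g; [exact: subgroup1|rewrite mulg1].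
apply: sub_finite_set (finite_fset D) => _ [g /UD[X DX Xg] <-].
have /set_mem[h Uh hX] := DU _ DX.
suff -> : lcoset V g = X by [].
move: Xg; rewrite -hX => -[v Vv <-]; apply/lcoset_eq => //.
by rewrite mulKg.
Qed.

Lemma subgroupI U V : is_subgroup U -> is_subgroup V -> is_subgroup (U `&` V).
Proof.
move=> sU sV; split; first by apply/mem_set; split; exact: subgroup1.
by move=> g h /set_mem[Ug Vg] /set_mem[Uh Vh]; apply/mem_set; split; exact: subgroup_div.
Qed.

Lemma compact_open_subgroupI U V : compact_open_subgroup U ->
  compact_open_subgroup V -> compact_open_subgroup (U `&` V).
Proof.
move=> [sU cU oU] [sV cV oV]; split; [exact: subgroupI| |exact: openI].
by apply: compact_closedI => //; exact: open_subgroup_closed.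
Qed.

Definition cosI (U V : cosubgroup G) : cosubgroup G :=
  COSubgroup (compact_open_subgroupI (cos_prop U) (cos_prop V)).

Lemma cosubgroup_finite (U V : cosubgroup G) : finite_set (lcosets U V).
Proof. by case: U V => [U [? ? ?]] [V [? ? ?]]; exact: compact_finite_lcosets. Qed.

Lemma cosubgroup_subgroup (U : cosubgroup G) : is_subgroup U.
Proof. by case: U => U []. Qed.
End Index.

Section ChiLine.
Variables (G : topGroupType) (U0 : cosubgroup G).
Implicit Types U V : cosubgroup G.

Local Notation free := {freeg (cosubgroup G) / rat}.

(** The Haar measure of V, normalised to be 1 on [U0]. *)
Definition haar (V : cosubgroup G) : rat^o :=
  (Defs.index V (cosI V U0))%:R / (Defs.index U0 (cosI V U0))%:R.

Local Hint Resolve cosubgroup_subgroup cosubgroup_finite : core.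

Lemma haar_gt0 V : 0 < haar V.
Proof. by rewrite divr_gt0 // ltr0n index_gt0. Qed.

(** All indices are compared over [cosI V U0], which every group involved contains. *)
Lemma haar_index U V : V `<=` U -> haar U = (Defs.index U V)%:R * haar V.
Proof.
move=> VU; have n0 (A B : cosubgroup G) : (Defs.index A B)%:R != 0 :> rat.
  by rewrite pnatr_eq0 -lt0n index_gt0.
have sub2 (A B : cosubgroup G) : cosI A B `<=` A by move=> x [].
have sub2r (A B : cosubgroup G) : cosI A B `<=` B by move=> x [].
have VUI : cosI V U0 `<=` cosI U U0 by move=> x [/VU Ux U0x].
have E1 := @index_mul _ U V (cosI V U0) ltac:(done) ltac:(done) ltac:(done) (sub2 _ _) VU ltac:(done).
have E2 := @index_mul _ U (cosI U U0) (cosI V U0) ltac:(done) ltac:(done) ltac:(done) VUI (sub2 _ _) ltac:(done).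
have E3 := @index_mul _ U0 (cosI U U0) (cosI V U0) ltac:(done) ltac:(done) ltac:(done) VUI (sub2r _ _) ltac:(done).
rewrite /haar E3; move/(congr1 (fun n => n%:R : rat)): E1; rewrite E2 !natrM => E.
rewrite mulrA -E -[RHS]mulf_div divff ?mulr1 //.
Qed.

Lemma chi_gen_haar V : chi_gen V = (haar V : rat) *: chi_gen U0.
Proof.
have n0 (A B : cosubgroup G) : (Defs.index A B)%:R != 0 :> rat.
  by rewrite pnatr_eq0 -lt0n index_gt0.
rewrite (chi_genE (V := cosI V U0) (U := V)); last by move=> x [].
rewrite (chi_genE (V := cosI V U0) (U := U0)); last by move=> x [].
by rewrite scalerA /haar divfK.
Qed.

Definition haar_free : free -> rat^o := fglift haar.

Lemma haar_free_zmod : zmod_morphism haar_free.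
Proof. by move=> D E; rewrite /haar_free lift_is_additive. Qed.

HB.instance Definition _ :=
  GRing.isZmodMorphism.Build free rat^o haar_free haar_free_zmod.

Lemma haar_freeZ : scalable haar_free.
Proof.
move=> a D; rewrite -[D]freeg_sumE scaler_sumr !raddf_sum.
apply: eq_bigr => U _ /=.
have -> : a *: << coeff U D *g U >> = << a * coeff U D *g U >> :> free.
  by apply/eqP/freeg_eqP => V; rewrite coeffZ !coeffU mulrA.
by rewrite /haar_free !liftU [RHS]scalerA.
Qed.

HB.instance Definition _ :=
  GRing.isScalable.Build rat free rat^o _ haar_free haar_freeZ.

Lemma haar_free_rel D : D \in @chi_pred G -> haar_free D = 0.
Proof.
move=> /set_mem DS; pose M := [set D | haar_free D = 0].
apply: (DS M); split=> [|_ [U [V [VU ->]]]].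
  split; first by apply/mem_set; rewrite /M /= linear0.
  move=> a u v /set_mem uM /set_mem vM; apply/mem_set.
  by rewrite /M /= linearP /= [haar_free u]uM [haar_free v]vM scaler0 addr0.
rewrite /M /= linearB linearZ /= /haar_free !liftU !scale1r.
by rewrite (haar_index VU) subrr.
Qed.

(** The coordinate on the line Q(chi) that is 1 on the class of [U0]; it turns forms with values in
    Q(chi) into rational ones. *)
Definition haar_chi (x : Qchi G) : rat^o := haar_free (repr x).

Lemma haar_chi_pi D : haar_chi (chi_pi D) = haar_free D.
Proof.
apply/eqP; rewrite -subr_eq0 -linearB; apply/eqP/haar_free_rel.
by apply/chi_piP; rewrite chi_pi_repr.
Qed.

Lemma haar_chi_linear : linear haar_chi.
Proof.
move=> a x y; rewrite -[x]chi_pi_repr -[y]chi_pi_repr -linearP !haar_chi_pi.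
exact: linearP.
Qed.

HB.instance Definition _ :=
  GRing.isLinear.Build rat (Qchi G) rat^o _ haar_chi haar_chi_linear.

Lemma haar_chi_gt0 x : chi_pos x -> 0 < haar_chi x.
Proof.
move=> [c [U [c0 ->]]]; rewrite linearZ /= /chi_gen haar_chi_pi.
by rewrite /haar_free liftU scale1r; apply: mulr_gt0 => //; exact: haar_gt0.
Qed.

(** Q(chi) is spanned by the class of [U0], so g acts by a scalar, which is read off on this
    class. *)
Lemma chi_act_index g x : U0 `<=` conjcos g U0 ->
  chi_module G g x = (Defs.index (conjcos g U0) U0)%:R *: x.
Proof.
move=> sub; apply: (@chi_ind _ (chi_act g) ( *:%R (Defs.index (conjcos g U0) U0)%:R)) => V.
rewrite /= chi_gen_haar linearZ /= chi_act_gen (chi_genE sub).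
by rewrite !scalerA mulrC.
Qed.
End ChiLine.

(** * Automorphism groups as topological groups *)

Section AutMorphism.
Variables (k F : fieldType) (iota : {rmorphism k -> F}).

HB.instance Definition _ (g : autOver iota) :=
  GRing.isZmodMorphism.Build F F g (aut_zmod g).
HB.instance Definition _ (g : autOver iota) :=
  GRing.isMonoidMorphism.Build F F g (aut_monoid g).

Definition fixer (s : seq F) : set (autOver iota) :=
  [set g | forall x, x \in s -> g x = x].

Lemma fixer_subgroup s : is_subgroup (fixer s).
Proof.
split; first by apply/mem_set => x _.
move=> g h /set_mem gs /set_mem hs; apply/mem_set => x xs.
by rewrite autM -[in LHS](hs x xs) autK gs.
Qed.

(** By the pointwise criterion [aut_cvgP], the filter generated by these groups converges to 1. *)
Lemma fixer_nbhs (A : set (autOver iota)) :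
  nbhs (1%g : autOver iota) A -> exists s, fixer s `<=` A.
Proof.
pose E : set_system (autOver iota) := [set A | exists s, fixer s `<=` A].
have FE : Filter E.
  split; first by exists [::].
    move=> B C [s sB] [t tC]; exists (s ++ t) => g gst; split.
      by apply: sB => x xs; apply: gst; rewrite mem_cat xs.
    by apply: tC => x xs; apply: gst; rewrite mem_cat xs orbT.
  by move=> B C BC [s sB]; exists s => g /sB /BC.
suff cvgE : E --> (1%g : autOver iota) by move=> /cvgE.
by apply/aut_cvgP => x; exists [:: x] => g; apply; rewrite inE.
Qed.

Lemma fixer_open s : open (fixer s).
Proof.
rewrite openE => g gs; rewrite /interior.
suff : nbhs g [set h : autOver iota | forall x, x \in s -> h x = g x].
  by apply: filterS => h hg x xs; rewrite hg ?gs.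
elim: s {gs} => [|y s IH]; first by apply: filterS filterT.
apply: filterS2 (aut_nbhs g y) IH => h hy hs x.
by rewrite inE => /orP[/eqP->|/hs].
Qed.

Lemma fixer_adjoin s (g : autOver iota) x :
  fixer s g -> adjoin iota [set` s] x -> g x = x.
Proof. by move=> gs; apply: (adjoin_fixP g _).2 => y; exact: gs. Qed.

Lemma aut_root (g : autOver iota) (p : {poly F}) x :
  (forall i, g p`_i = p`_i) -> root p x -> root p (g x).
Proof.
move=> gp /rootP px; have gpE : map_poly g p = p.
  by apply/polyP => i; rewrite coef_map /= gp.
by apply/rootP; rewrite -{1}gpE horner_map px rmorph0.
Qed.
End AutMorphism.
Arguments fixer {k F} iota s.
Arguments fixer_subgroup {k F} iota s.
Arguments fixer_open {k F} iota s.

Section Compact.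
Variables (k : fieldType) (F : closedFieldType) (iota : {rmorphism k -> F}).

Lemma ultra_mem_seq (T : Type) (E : set_system T) (f : T -> F) (r : seq F) :
  UltraFilter E -> E [set h | f h \in r] -> exists y, E [set h | f h = y].
Proof.
move=> UE; elim: r => [E0|y r IH Er].
  by have [h] := filter_ex E0; rewrite /= in_nil.
have [|Ey] := in_ultra_setVsetC [set h | f h = y] UE; first by exists y.
apply: IH; apply: filterS2 Er Ey => h /=.
by rewrite inE => /orP[/eqP|].
Qed.

Lemma fixer_conjugates s x : algebraic_over (adjoin iota [set` s]) x ->
  exists r : seq F, forall h, fixer iota s h -> h x \in r.
Proof.
move=> [p [p0 pK px]]; have [r rE] := closed_field_poly_normal p.
exists r => h hs; have := aut_root (g := h) (fun i => fixer_adjoin hs (pK i)) px.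
by rewrite rE rootZ ?lead_coef_eq0 // root_prod_XsubC.
Qed.

(** Orbits in F are finite, so an ultrafilter fixes the value at each point of F, and the pointwise
    limit is an automorphism. The inverses get a limit of their own, which becomes [aut_inv]. *)
Lemma fixer_compact s :
  (forall x, algebraic_over (adjoin iota [set` s]) x) -> compact (fixer iota s).
Proof.
move=> alg; rewrite compact_ultra => E UE Es.
have roots x := fixer_conjugates (alg x).
have lim (f : autOver iota -> autOver iota) : (forall h, fixer iota s h -> fixer iota s (f h)) ->
    exists g : F -> F, forall x, E [set h : autOver iota | f h x = g x].
  move=> fs; have /choice[g gP] x : exists y, E [set h : autOver iota | f h x = y].
    have [r rP] := roots x; apply: (ultra_mem_seq (r := r)).
    by apply: filterS Es => h hs; apply: rP; exact: fs.
  by exists g.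
have [g gP] := lim id (fun _ => id).
have [g' g'P] := lim (fun h => h^-1%g) (fun h hs => subgroupV (fixer_subgroup iota s) hs).
have gB : zmod_morphism g.
  move=> x y; have [h [[<- <-] <-]] := filter_ex (filterI (filterI (gP x) (gP y)) (gP (x - y))).
  exact: aut_zmod.
have gM : monoid_morphism g.
  split; first by have [h <-] := filter_ex (gP 1); exact: (aut_monoid h).1.
  move=> x y; have [h [[<- <-] <-]] := filter_ex (filterI (filterI (gP x) (gP y)) (gP (x * y))).
  exact: (aut_monoid h).2.
have gK : cancel g g'.
  by move=> x; have [h [hx <-]] := filter_ex (filterI (gP x) (g'P (g x))); rewrite -hx autK.
have g'K : cancel g' g.
  by move=> x; have [h [hx <-]] := filter_ex (filterI (g'P x) (gP (g' x))); rewrite -hx autKV.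
have gk c : g (iota c) = iota c.
  by have [h <-] := filter_ex (gP (iota c)); exact: aut_base.
exists (AutOver gB gM gK g'K gk); split.
  by move=> x xs /=; have [h [hs <-]] := filter_ex (filterI Es (gP x)); exact: hs.
exact/aut_cvgP.
Qed.

Definition fixer_cos s (alg : forall x, algebraic_over (adjoin iota [set` s]) x) :
    cosubgroup (autOver iota) :=
  COSubgroup (And3 (fixer_subgroup iota s) (fixer_compact alg) (fixer_open iota s)).
End Compact.

Section Kernel.
Variables (k F : fieldType) (iota : {rmorphism k -> F}).
Variables (W : lmodType rat) (rho : gmodule (autOver iota) W).

Lemma smooth_kernel : smooth rho -> fin_dim [set: W] ->
  exists s, forall g, fixer iota s g -> forall w, rho g w = w.
Proof.
move=> sm [m [e [_ span]]].
have [s sP] : exists s, fixer iota s `<=` [set g | forall i, stabilizer rho (e i) g].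
  apply: fixer_nbhs; pose ngb : set_system (autOver iota) := nbhs (1%g : autOver iota).
  have FF : Filter ngb := nbhs_filter _.
  apply: (@filter_forall _ _ (fun i => stabilizer rho (e i)) ngb FF) => i.
  apply: open_nbhs_nbhs; split; [exact: sm|exact: gact1].
exists s => g gs w; have [c ->] := span w I.
rewrite linear_sum; apply: eq_bigr => i _.
by rewrite linearZ /=; congr (_ *: _); exact: sP.
Qed.
End Kernel.

(** * Relative algebraic closures *)

Section SubField.
Variables (F : fieldType) (K : set F) (dK : GRing.divring_closed [in K]).

Definition subfield_pred of GRing.divring_closed [in K] : {pred F} := [in K].
HB.instance Definition _ :=
  GRing.isDivringClosed.Build F (subfield_pred dK) dK.
Definition subfield := {x : F | x \in subfield_pred dK}.
HB.instance Definition _ := SubType.on subfield.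
HB.instance Definition _ := Choice.on subfield.
HB.instance Definition _ := [SubChoice_isSubIntegralDomain of subfield by <:].
HB.instance Definition _ := [SubIntegralDomain_isSubField of subfield by <:].

Definition subfield_val : {rmorphism subfield -> F} := val.

Lemma subfield_valP (x : subfield) : K (val x).
Proof. exact/set_mem/(valP x). Qed.

Lemma algebraic_over_subfield x :
  algebraic_over K x <-> algebraicOver subfield_val x.
Proof.
split=> [[p [p0 pK px]]|[p p0 px]]; last first.
  exists (map_poly subfield_val p); split=> //; first by rewrite map_poly_eq0.
  by move=> i; rewrite coef_map; exact: subfield_valP.
pose q : {poly subfield} := \poly_(i < size p) (Sub p`_i (mem_set (pK i)) : subfield).
have qE : map_poly subfield_val q = p.
  apply/polyP => i; rewrite coef_map coef_poly; case: ltnP => // pi.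
  by rewrite nth_default.
by exists q; rewrite ?qE // -(map_poly_eq0 subfield_val) qE.
Qed.

Lemma algebraic_over_id x : K x -> algebraic_over K x.
Proof.
move=> Kx; apply/algebraic_over_subfield.
exact: (algebraic_id subfield_val (Sub x (mem_set Kx))).
Qed.

Definition alg_closure : set F := [set x | algebraic_over K x].

Lemma alg_closure_divring : GRing.divring_closed [in alg_closure].
Proof.
split.
- by apply/mem_set/algebraic_over_subfield; exact: algebraic1.
- move=> x y /set_mem/algebraic_over_subfield xK /set_mem/algebraic_over_subfield yK.
  by apply/mem_set/algebraic_over_subfield; exact: algebraic_sub.
- move=> x y /set_mem/algebraic_over_subfield xK /set_mem/algebraic_over_subfield yK.
  by apply/mem_set/algebraic_over_subfield; exact: algebraic_div.
Qed.

Lemma alg_closure_trans x : algebraic_over alg_closure x -> algebraic_over K x.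
Proof.
move=> [p [p0 pK px]]; apply/algebraic_over_subfield/integral_algebraic.
apply: (integral_root p0 px) => _ /(nthP 0)[i _ <-].
by apply/integral_algebraic/algebraic_over_subfield; exact: pK.
Qed.
End SubField.

Lemma adjoin_divring (k F : fieldType) (iota : {rmorphism k -> F}) A :
  GRing.divring_closed [in adjoin iota A].
Proof.
split; first by apply/mem_set => M /= [[M1 _ _] _]; exact/set_mem.
- move=> x y /set_mem xS /set_mem yS; apply/mem_set => M /= MM; have [[_ MB _] _] := MM.
  by apply/set_mem/MB; apply/mem_set; [exact: xS|exact: yS].
- move=> x y /set_mem xS /set_mem yS; apply/mem_set => M /= MM; have [[_ _ MV] _] := MM.
  by apply/set_mem/MV; apply/mem_set; [exact: xS|exact: yS].
Qed.

Lemma adjoin_sub (k F : fieldType) (iota : {rmorphism k -> F}) A (K : set F) :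
  GRing.divring_closed [in K] -> (forall c, K (iota c)) -> A `<=` K -> adjoin iota A `<=` K.
Proof. by move=> dK kK AK x; apply; split=> // y [[c _ <-]|/AK]. Qed.

Lemma adjoin_base (k F : fieldType) (iota : {rmorphism k -> F}) A c : adjoin iota A (iota c).
Proof. by apply: sub_gen_smallest; left; exists c. Qed.

Lemma adjoin_gen (k F : fieldType) (iota : {rmorphism k -> F}) A x : A x -> adjoin iota A x.
Proof. by move=> Ax; apply: sub_gen_smallest; right. Qed.

Section AlgClosure.
Variables (F : closedFieldType) (K : set F) (dK : GRing.divring_closed [in K]).

Definition aclosure := subfield (alg_closure_divring dK).
HB.instance Definition _ := GRing.Field.on aclosure.

Lemma aclosure_closed : GRing.closed_field_axiom aclosure.
Proof.
move=> n P n0.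
have [x xE] := @solve_monicpoly F n (fun i => val (P i)) n0.
have xK : alg_closure K x.
{
  apply: alg_closure_trans => //.
  exists ('X^n - \poly_(i < n) val (P i)); split.
  - by rewrite -size_poly_gt0 size_polyDl ?size_polyXn // size_polyN ltnS size_poly.
  - move=> i; rewrite coefB coefXn coef_poly.
    have [a1 aB _] := alg_closure_divring dK.
    have a0 : 0 \in alg_closure K by rewrite -(subrr 1); exact: aB.
    apply/set_mem/aB; first by case: eqP => _.
    by case: ifP => _ //; apply/mem_set; exact: subfield_valP.
  - by rewrite rootE !hornerE xE horner_poly subrr.
}
exists (Sub x (mem_set xK)); apply: val_inj.
pose v : {rmorphism aclosure -> F} := (val : aclosure -> F).
transitivity (x ^+ n); first exact: (rmorphXn v).
rewrite xE; apply/esym; rewrite -[LHS]/(v _) rmorph_sum.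
by apply: eq_bigr => i _; rewrite rmorphM rmorphXn.
Qed.
HB.instance Definition _ := Field_isAlgClosed.Build aclosure aclosure_closed.

Definition aclosure_val : {rmorphism aclosure -> F} := (val : aclosure -> F).
End AlgClosure.

(** * Relations in transcendence degree one *)

Lemma divring_D (F : fieldType) (K : set F) x y : GRing.divring_closed [in K] ->
  K x -> K y -> K (x + y).
Proof.
move=> dK Kx Ky; have [K1 KB _] := dK.
have K0 : 0 \in K by rewrite -(subrr 1); exact: KB.
by rewrite -[y]opprK -[- y]sub0r; apply/set_mem/KB; [exact/mem_set|apply: KB => //; exact/mem_set].
Qed.

Lemma divring_M (F : fieldType) (K : set F) x y : GRing.divring_closed [in K] ->
  K x -> K y -> K (x * y).
Proof.
move=> dK Kx Ky; have [K1 _ KV] := dK.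
by rewrite -[y]invrK -[y^-1]div1r; apply/set_mem/KV; [exact/mem_set|apply: KV => //; exact/mem_set].
Qed.

Section Ev.
Variables (k F : fieldType) (iota : {rmorphism k -> F}).

Definition eval_at (x : F) (p : {poly k}) : F := (map_poly iota p).[x].
HB.instance Definition _ x := GRing.RMorphism.copy (eval_at x) (horner_eval x \o map_poly iota).

Local Notation evp := eval_at.

(* P(x, y), where x stands for the inner variable of P. *)
Definition eval_at2 (x y : F) (P : {poly {poly k}}) : F := (map_poly (evp x) P).[y].
HB.instance Definition _ x y := GRing.RMorphism.copy (eval_at2 x y) (horner_eval y \o map_poly (evp x)).
Local Notation ev2 := eval_at2.

Lemma ev2B x y P Q : ev2 x y (P - Q) = ev2 x y P - ev2 x y Q.
Proof. exact: rmorphB. Qed.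
Lemma ev2M x y P Q : ev2 x y (P * Q) = ev2 x y P * ev2 x y Q.
Proof. exact: rmorphM. Qed.
Lemma ev2C x y p : ev2 x y p%:P = evp x p.
Proof. by rewrite /eval_at2 map_polyC hornerC. Qed.
Lemma ev2X x y : ev2 x y 'X = y.
Proof. by rewrite /eval_at2 map_polyX hornerX. Qed.
Lemma evpX x : evp x 'X = x.
Proof. by rewrite /eval_at map_polyX hornerX. Qed.
Lemma evpC x c : evp x c%:P = iota c.
Proof. by rewrite /eval_at map_polyC hornerC. Qed.

Lemma ev2_horner x y P :
  ev2 x y P = (map_poly (map_poly iota) P).[y%:P].[x].
Proof.
rewrite -[RHS]/(horner_eval x _) -horner_map /eval_at2 -map_poly_comp.
by congr (_.[_]); rewrite /= /horner_eval hornerC.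
Qed.

Lemma ev2_swap x y P : ev2 x y (swapXY P) = ev2 y x P.
Proof.
by rewrite !ev2_horner -swapXY_map; exact: horner2_swapXY.
Qed.

Lemma adjoin_evp (A : set F) x p : A x -> adjoin iota A (evp x p).
Proof.
move=> Ax; have dK := adjoin_divring iota A.
elim/poly_ind: p => [|p c IH]; first by rewrite rmorph0 -(rmorph0 iota); exact: adjoin_base.
rewrite rmorphD rmorphM /= evpX evpC; apply: (divring_D dK); last exact: adjoin_base.
by apply: (divring_M dK) => //; exact: adjoin_gen.
Qed.

Lemma aut_evp (g : autOver iota) x p : g (evp x p) = evp (g x) p.
Proof.
rewrite /eval_at -horner_map -map_poly_comp; congr (_.[_]).
by apply: eq_map_poly => c /=; rewrite aut_base.
Qed.

(** Elements of k(x) are quotients of polynomials in x; clearing the denominators in an equation of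
    y leaves polynomial coefficients. *)
Lemma algebraic_relation x y : algebraic_over (adjoin iota [set x]) y ->
  (forall p, p != 0 -> evp x p != 0) ->
  exists2 P : {poly {poly k}}, P != 0 & ev2 x y P = 0.
Proof.
move=> [p [p0 pK /rootP py]] trx.
pose K : set F := [set z | exists a b : {poly k}, b != 0 /\ z = evp x a / evp x b].
have dK : GRing.divring_closed [in K].
  split.
  - apply/mem_set; exists 1, 1; rewrite oner_eq0; split=> //.
    by rewrite rmorph1 divr1.
  - move=> _ _ /set_mem[a [b [b0 ->]]] /set_mem[c [d [d0 ->]]]; apply/mem_set.
    exists (a * d - c * b), (b * d); rewrite mulf_neq0 //; split=> //.
    by rewrite !rmorphB !rmorphM; field; rewrite !trx.
  - move=> _ _ /set_mem[a [b [b0 ->]]] /set_mem[c [d [d0 ->]]]; apply/mem_set.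
    have [->|c0] := eqVneq c 0.
      exists 0, 1; rewrite oner_eq0; split=> //.
      by rewrite !rmorph0 mul0r invr0 mulr0 mul0r.
    exists (a * d), (b * c); rewrite mulf_neq0 //; split=> //.
    by rewrite !rmorphM; field; rewrite !trx.
have AK : adjoin iota [set x] `<=` K.
  apply: adjoin_sub => // [c|_ ->].
    by exists c%:P, 1; rewrite oner_eq0 evpC rmorph1 divr1.
  by exists 'X, 1; rewrite oner_eq0 evpX rmorph1 divr1.
have [D [P [D0 PE]]] : exists (D : {poly k}) (P : {poly {poly k}}),
    D != 0 /\ map_poly (evp x) P = evp x D *: p.
  have : forall i, K p`_i by move=> i; exact: AK.
  elim/poly_ind: p {p0 pK py} => [_|q c IH qK].
    by exists 1, 0; rewrite oner_eq0 rmorph0 scaler0.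
  have [|D [P [D0 PE]]] := IH.
    by move=> i; have := qK i.+1; rewrite coefD coefMX coefC /= addr0.
  have [a [b [b0 cE]]] : K c by have := qK 0%N; rewrite coefD coefMX coefC /= add0r.
  exists (D * b), (b *: P * 'X + (D * a)%:P); rewrite mulf_neq0 //; split=> //.
  rewrite rmorphD rmorphM /= map_polyX map_polyZ PE map_polyC /= !rmorphM /=.
  rewrite scalerDr cE -!mul_polyC !polyCM; congr (_ + _); first by ring.
  by rewrite -!polyCM; congr _%:P; field; rewrite trx.
exists P; last by rewrite /eval_at2 PE hornerZ py mulr0.
apply: contra_neq p0 => P0; apply/eqP; move/eqP: PE.
by rewrite P0 rmorph0 eq_sym scaler_eq0 (negPf (trx _ D0)).
Qed.

End Ev.

Section Transcendental.
Variables (k F : closedFieldType) (iota : {rmorphism k -> F}).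
Local Notation evp := (eval_at iota).
Local Notation ev2 := (eval_at2 iota).
Local Notation algK x := (forall z, algebraic_over (adjoin iota [set x]) z).

(** As k is algebraically closed, p is a product of linear factors: every element outside the image
    of k is transcendental. This is why transcendence takes the form [~ range iota x]. *)
Lemma evp_neq0 x p : ~ range iota x -> p != 0 -> evp x p != 0.
Proof.
move=> xk p0; have [r ->] := closed_field_poly_normal p.
rewrite -mul_polyC rmorphM /= evpC mulf_neq0 ?fmorph_eq0 ?lead_coef_eq0 //.
rewrite rmorph_prod prodf_seq_neq0; apply/allP => c _; apply/implyP => _.
rewrite rmorphB /= evpX evpC subr_eq0.
by apply/eqP => xE; apply: xk; exists c.
Qed.

(** Steinitz exchange: a relation between t and x, read as a polynomial in t, makes t algebraic over
    k(x). *)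
Lemma algebraic_exchange t x : ~ range iota t -> ~ range iota x -> algK t -> algK x.
Proof.
move=> tk xk algt z; have dx := adjoin_divring iota [set x].
have [P P0 PE] := algebraic_relation (algt x) (fun p => evp_neq0 tk (p := p)).
apply: (alg_closure_trans dx); apply: algebraic_over_sub (algt z).
apply: adjoin_sub; [exact: alg_closure_divring|move=> c|move=> _ ->].
  by apply: (algebraic_over_id dx); exact: adjoin_base.
exists (map_poly (evp x) (swapXY P)); split.
- rewrite map_poly_eq0_id0 ?swapXY_eq0 // evp_neq0 // lead_coef_eq0 swapXY_eq0 //.
- by move=> i; rewrite coef_map; exact: adjoin_evp.
- by apply/rootP; rewrite -[LHS]/(ev2 x t (swapXY P)) ev2_swap.
Qed.

(** Equal relations give an isomorphism from k(t, y) to k(x, y'), with graph [R]; it extends to F,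
    which is algebraic over both fields. *)
Lemma aut_of_relations t x y y' : ~ range iota t -> ~ range iota x -> algK t ->
  (forall f, ev2 t y f = 0 <-> ev2 x y' f = 0) ->
  exists g : autOver iota, g t = x /\ g y = y'.
Proof.
move=> tk xk algt rel; have algx := algebraic_exchange tk xk algt.
pose R : set (F * F) := [set a | exists f h, [/\ ev2 t y h != 0,
  a.1 = ev2 t y f / ev2 t y h & a.2 = ev2 x y' f / ev2 x y' h]].
have reln f : (ev2 t y f == 0) = (ev2 x y' f == 0) by apply/eqP/eqP => /rel.
have Rev f : R (ev2 t y f, ev2 x y' f).
  by exists f, 1; rewrite !rmorph1 !divr1 oner_eq0.
have RP : partial_iso iota R.
  split=> [c||[a b] [f [h [h0 /= -> ->]]]].
  - by have := Rev c%:P%:P; rewrite !ev2C !evpC.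
  - split.
    + by apply/mem_set; have := Rev 1; rewrite !rmorph1.
    + move=> [a1 a2] [b1 b2] /set_mem[f [h [h0 /= -> ->]]] /set_mem[f' [h' [h0' /= -> ->]]].
      apply/mem_set; exists (f * h' - f' * h), (h * h').
      have h20 : ev2 x y' h != 0 by rewrite -reln.
      have h20' : ev2 x y' h' != 0 by rewrite -reln.
      rewrite !ev2B !ev2M; split; first exact: mulf_neq0.
        by rewrite /=; field; rewrite h0 h0'.
      by rewrite /=; field; rewrite h20 h20'.
    + move=> [a1 a2] [b1 b2] /set_mem[f [h [h0 /= -> ->]]] /set_mem[f' [h' [h0' /= -> ->]]].
      have h20 : ev2 x y' h != 0 by rewrite -reln.
      have h20' : ev2 x y' h' != 0 by rewrite -reln.
      apply/mem_set; have [f0|f0] := eqVneq (ev2 t y f') 0.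
        have f20 : ev2 x y' f' = 0 by exact/rel.
        rewrite f0 f20 !mul0r (_ : (0, 0) = 0 :> F * F) // invr0 mulr0.
        by have := Rev 0; rewrite !rmorph0.
      have f20 : ev2 x y' f' != 0 by rewrite -reln.
      pose A : F * F := (ev2 t y f' / ev2 t y h', ev2 x y' f' / ev2 x y' h').
      pose B : F * F := (ev2 t y h' / ev2 t y f', ev2 x y' h' / ev2 x y' f').
      have AB : A * B = 1 by congr pair => /=; field; rewrite ?f0 ?h0' ?f20 ?h20'.
      have U : A \is a GRing.unit by apply/unitrP; exists B; rewrite mulrC AB.
      rewrite -/A (_ : A^-1 = B); last by apply: (mulrI U); rewrite mulrV.
      exists (f * h'), (h * f'); rewrite !ev2M; split; first exact: mulf_neq0.
        by rewrite /=; field; rewrite ?h0 ?h0' ?f0.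
      by rewrite /=; field; rewrite ?h20 ?h20' ?f20.
  - by rewrite !mulf_eq0 !invr_eq0 -!reln.
have domt : adjoin iota [set t] `<=` [set a.1 | a in R].
  apply: adjoin_sub; [exact: piso_dom_divring RP|move=> c|move=> _ ->].
    by exists (iota c, iota c) => //; case: RP.
  by exists (ev2 t y 'X%:P, ev2 x y' 'X%:P); [exact: Rev|rewrite /= ev2C evpX].
have codx : adjoin iota [set x] `<=` [set a.2 | a in R].
  have -> : [set a.2 | a in R] = [set a.1 | a in [set a | R (a.2, a.1)]].
    by apply/seteqP; split=> _ [[a b] Rab <-]; exists (b, a).
  apply: adjoin_sub; [exact: piso_dom_divring (piso_swap RP)|move=> c|move=> _ ->].
    by exists (iota c, iota c) => //=; case: RP.
  by exists (ev2 x y' 'X%:P, ev2 t y 'X%:P); [exact: Rev|rewrite /= ev2C evpX].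
have [||g gP] := piso_extend RP.
- by move=> z; exact: algebraic_over_sub domt (algt z).
- by move=> z; exact: algebraic_over_sub codx (algx z).
exists g; split.
  by have := gP _ (Rev 'X%:P); rewrite /= !ev2C !evpX.
by have := gP _ (Rev 'X); rewrite /= !ev2X.
Qed.
End Transcendental.

(** * Generic points of a plane curve *)

Section MinimalRelation.
Variables (k F : closedFieldType) (iota : {rmorphism k -> F}).
Local Notation evp := (eval_at iota).
Local Notation ev2 := (eval_at2 iota).
Local Notation algK x := (forall z, algebraic_over (adjoin iota [set x]) z).

Variables (t y : F) (P : {poly {poly k}}).
Hypotheses (tk : ~ range iota t) (Pmon : P \is monic) (Py : ev2 t y P = 0).
Hypothesis Pmin : forall Q : {poly {poly k}}, Q != 0 -> (size Q < size P)%N -> ev2 t y Q != 0.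

Lemma minrel_size : (1 < size P)%N.
Proof.
rewrite ltnNge; apply/negP => /size1_polyC E; move: Py; rewrite E ev2C => py.
have p1 : P`_0 = 1 by apply/eqP; have := Pmon; rewrite {1}E monicE lead_coefC.
by move/eqP: py; rewrite p1 rmorph1 oner_eq0.
Qed.

(** A common factor g would give c P = q g with both q and g of smaller degree than P, and one of
    them would vanish at (t, y). *)
Lemma minrel_resultant (r : {poly {poly k}}) : (1 < size r)%N -> (size r < size P)%N -> resultant P r != 0.
Proof.
move=> r1 rP; rewrite resultant_eq0 -leqNgt leqNgt; apply/negP => g1.
have r0 : r != 0 by rewrite -size_poly_gt0 (ltn_trans _ r1).
have gr := leq_trans (Pdiv.Idomain.dvdp_leq r0 (dvdp_gcdr P r)) (leqnn _).
have /Pdiv.Idomain.dvdpP[[c q] /= c0 cq] := dvdp_gcdl P r.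
set g := gcdp P r in g1 gr cq.
have g0 : g != 0 by rewrite -size_poly_gt0 (ltn_trans _ g1).
have P0 := monic_neq0 Pmon.
have q0 : q != 0.
  by apply: contra_neq c0 => q0; apply/eqP; move/eqP: cq; rewrite q0 mul0r scale_poly_eq0 (negPf P0) orbF.
have : ev2 t y (c *: P) = 0 by rewrite -mul_polyC ev2M Py mulr0.
rewrite cq ev2M => /eqP; rewrite mulf_eq0; apply/negP; rewrite negb_or.
rewrite !Pmin //; first exact: leq_ltn_trans gr rP.
have : size (q * g) = size P by rewrite -cq size_scale.
by rewrite size_mul //; move: g1; case: (size g) => [|[|m]] // _; rewrite !addnS /= => <-; rewrite ltnS leq_addr.
Qed.

(** As P is monic, f may be replaced by its remainder r. At (t, y) a nonzero r does not vanish by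
    minimality. At (x, y') its vanishing would make the resultant of P and r, a nonzero polynomial,
    vanish at the transcendental x. *)
Lemma minrel_relations x y' : ~ range iota x -> ev2 x y' P = 0 ->
  forall f, ev2 t y f = 0 <-> ev2 x y' f = 0.
Proof.
move=> xk Py' f; have P0 := monic_neq0 Pmon.
have rs : (size (Pdiv.Ring.rmodp f P) < size P)%N by rewrite Pdiv.Ring.ltn_rmodpN0.
have E := Pdiv.RingMonic.rdivp_eq Pmon f.
set r := Pdiv.Ring.rmodp f P in rs E; set q := Pdiv.Ring.rdivp f P in E.
have evD a b : ev2 a b f = ev2 a b q * ev2 a b P + ev2 a b r.
  by rewrite E rmorphD; congr (_ + _); exact: ev2M.
rewrite !evD Py Py' !mulr0 !add0r.
have [->|r0] := eqVneq r 0; first by rewrite !rmorph0.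
split=> [/eqP|/eqP r20]; first by rewrite (negPf (Pmin r0 rs)).
exfalso; have [r1|r1] := leqP (size r) 1.
  move: r20 r0; rewrite (size1_polyC r1) ev2C polyC_eq0 => /[swap] r0.
  by rewrite (negPf (evp_neq0 xk r0)).
have [[u v] /= _ uv] := resultant_in_ideal minrel_size r1.
have := evp_neq0 xk (minrel_resultant r1 rs).
rewrite -(ev2C iota x y') uv rmorphD.
rewrite [X in X + _](ev2M iota x y' u P) [X in _ + X](ev2M iota x y' v r).
by rewrite Py' (eqP r20) !mulr0 addr0 eqxx.
Qed.

Lemma minrel_conjugate x y' : algK t -> ~ range iota x -> ev2 x y' P = 0 ->
  exists g : autOver iota, g t = x /\ g y = y'.
Proof. by move=> algt xk Py'; apply: aut_of_relations => //; exact: minrel_relations. Qed.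
End MinimalRelation.

(** * Counting cosets by roots *)

Section Orbit.
Variables (k : fieldType) (F : closedFieldType) (iota : {rmorphism k -> F}).

(** Since N contains the stabiliser of x0, sending h x0 to h N is a well-defined map from the roots
    of f onto the cosets. Elements of H permute the roots with their multiplicities, so all fibres
    have the same size n1. *)
Lemma index_dvd_degree (H N : set (autOver iota)) (f : {poly F}) (x0 : F) :
  is_subgroup H -> is_subgroup N -> f != 0 ->
  (forall h i, H h -> h f`_i = f`_i) -> root f x0 ->
  (forall x, root f x -> exists2 h, H h & h x0 = x) ->
  (forall h, H h -> h x0 = x0 -> N h) ->
  (Defs.index H N %| (size f).-1)%N.
Proof.
move=> sH sN f0 Hf fx0 conj stab.
have [rs fE] := closed_field_poly_normal f.
have rsP x : root f x = (x \in rs) by rewrite fE rootZ ?lead_coef_eq0 // root_prod_XsubC.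
have sf : (size f).-1 = size rs.
  by rewrite fE size_scale ?lead_coef_eq0 // size_prod_XsubC.
have /choice[c cP] x : exists h, x \in rs -> H h /\ h x0 = x.
  have [xr|nx] := boolP (x \in rs); last by exists 1%g.
  by have [h Hh hx] := conj x (etrans (rsP x) xr); exists h.
pose ga x := lcoset N (c x).
have gaE h : H h -> ga (h x0) = lcoset N h.
  move=> Hh; have hr : h x0 \in rs by rewrite -rsP; apply: aut_root => // i; exact: Hf.
  have [Hc cE] := cP _ hr; apply/lcoset_eq => //; apply: stab.
    by apply: subgroupM => //; exact: subgroupV.
  by rewrite autM cE autK.
have x0r : x0 \in rs by rewrite -rsP.
pose S := undup (map ga rs).
have -> : Defs.index H N = size S.
  apply: card_fset_set_seq; first exact: undup_uniq.
  move=> X; rewrite mem_undup; split=> [[h Hh <-]|/mapP[x xr ->]].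
    apply/mapP; exists (h x0); last by rewrite gaE.
    by rewrite -rsP; apply: aut_root => // i; exact: Hf.
  by have [Hc _] := cP _ xr; exists (c x).
pose n1 := count (fun x => ga x == lcoset N 1%g) rs.
have cnt X : X \in S -> count (fun x => ga x == X) rs = n1.
  rewrite mem_undup => /mapP[x xr ->]; have [Hc cE] := cP _ xr.
  have prs : perm_eq (map (c x) rs) rs.
    apply: prod_XsubC_eq.
    have lf : lead_coef f != 0 by rewrite lead_coef_eq0.
    have fc : map_poly (c x) f = f by apply/polyP => i; rewrite coef_map /= Hf.
    have := fc; rewrite {1 2}fE map_polyZ /= lead_coefE Hf // -lead_coefE.
    move=> /(scalerI lf) <-; rewrite big_map rmorph_prod /=.
    by apply: eq_bigr => z _; rewrite map_polyXsubC.
  rewrite -(permP prs) count_map /n1; apply: eq_in_count => z zr /=.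
  have [Hz zE] := cP _ zr.
  rewrite -{1}zE -autM gaE; last exact: subgroupM.
  apply/eqP/eqP => /lcoset_eq E; apply/lcoset_eq => //.
    by have := E sN; rewrite invg1 mul1g mulKg.
  by have := E sN; rewrite invg1 mul1g mulKg.
rewrite sf; apply/dvdnP; exists n1.
have -> : size rs = (\sum_(x <- rs) \sum_(X <- S) nat_of_bool (ga x == X))%N.
  rewrite -sum1_size big_seq [RHS]big_seq; apply: eq_bigr => x xr.
  have -> : (\sum_(X <- S) nat_of_bool (ga x == X) = count_mem (ga x) S)%N.
    by rewrite -sum1_count [RHS]big_mkcond /=; apply: eq_bigr => X _; rewrite eq_sym; case: eqP.
  by rewrite count_uniq_mem ?undup_uniq // mem_undup map_f.
rewrite exchange_big /= big_seq (eq_bigr (fun=> n1)) => [|X XS].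
  by rewrite -big_seq big_const_seq iter_addn_0 count_predT.
by rewrite -(cnt X XS) -sum1_count [RHS]big_mkcond; apply: eq_bigr => x _; case: eqP.
Qed.
End Orbit.

(** * Branches, primitive elements and simple points *)

Lemma horner_horner (R : comNzRingType) (Q : {poly {poly R}}) (a : {poly R}) c :
  Q.[a].[c] = (map_poly (horner_eval c) Q).[a.[c]].
Proof. by rewrite -[LHS]/(horner_eval c _) -horner_map. Qed.

(** Newton's method in powers of X - c0: a is the power series branch through (c0, y0), truncated to
    degree i. The correction c cancels the value at c0 of the quotient b. *)
Lemma hensel_poly (k : fieldType) (P : {poly {poly k}}) (c0 y0 : k) i :
  P.[y0%:P].[c0] = 0 -> P^`().[y0%:P].[c0] != 0 ->
  exists a : {poly k}, [/\ (size a <= i.+1)%N, a.[c0] = y0 &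
    ('X - c0%:P) ^+ i.+1 %| P.[a]].
Proof.
move=> P0 P1; pose w : {poly k} := 'X - c0%:P.
elim: i => [|i [a [sa a0 /dvdpP[b bE]]]].
  exists y0%:P; rewrite hornerC size_polyC_leq1 expr1 dvdp_XsubCl; split=> //.
  exact/rootP.
have P1a : P^`().[a].[c0] != 0.
  by move: P1; rewrite !horner_horner hornerC a0.
pose c := - b.[c0] / P^`().[a].[c0].
have [z zE] := horner_taylor2 P a (c%:P * w ^+ i.+1).
exists (a + c%:P * w ^+ i.+1); split.
- rewrite (leq_trans (size_polyD _ _)) // geq_max (leq_trans sa) //.
  by rewrite mul_polyC (leq_trans (size_scale_leq _ _)) // size_exp_XsubC.
- by rewrite hornerD hornerM horner_exp hornerXsubC subrr expr0n mulr0 addr0.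
have -> : P.[a + c%:P * w ^+ i.+1] =
    w ^+ i.+1 * (b + c%:P * P^`().[a]) + w ^+ i.+2 * (c%:P ^+ 2 * w ^+ i * z).
  by rewrite zE bE -/w !exprS; ring.
apply: dvdp_add; last by rewrite dvdp_mulIl.
rewrite exprSr dvdp_mul // dvdp_XsubCl; apply/rootP.
by rewrite hornerD hornerM hornerC /c divfK // subrr.
Qed.

(** Where p X + 1 vanishes, p does not. *)
Lemma closed_nonroot (k : closedFieldType) (p : {poly k}) : p != 0 -> exists c, p.[c] != 0.
Proof.
move=> p0; have /closed_rootP[c] : size (p * 'X + 1) != 1%N.
  rewrite size_MXaddC (negPf p0) /= eqSS size_poly_eq0 //.
rewrite rootE !hornerE /= => E; exists c; apply: contraTneq E => ->.
by rewrite mul0r add0r oner_eq0.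
Qed.

Section Main.
Variables (k F : closedFieldType) (iota : {rmorphism k -> F}).
Hypothesis char0 : [pchar k] =i pred0.
Local Notation evp := (eval_at iota).
Local Notation ev2 := (eval_at2 iota).
Local Notation algK x := (forall z, algebraic_over (adjoin iota [set x]) z).

Lemma natr_fieldF (n : nat) : (n%:R == 0 :> F) = (n == 0%N).
Proof. by rewrite -(rmorph_nat iota) fmorph_eq0 ((pcharf0P k).1 char0). Qed.

Lemma avoid_nat (L : seq F) : exists n : nat, n%:R \notin L.
Proof.
apply: contrapT => none.
pose s := [seq (n%:R : F) | n <- seq.iota 0 (size L).+1].
have us : uniq s.
  rewrite map_inj_uniq ?iota_uniq // => a b; wlog ab : a b / (a <= b)%N => [H|].
    by case/orP: (leq_total a b) => /H // H1 /esym /H1 ->.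
  move/eqP; rewrite eq_sym -subr_eq0 -natrB // natr_fieldF subn_eq0 => ba.
  by apply/eqP; rewrite eqn_leq ab.
have sL : {subset s <= L}.
  move=> _ /mapP[n _ ->]; apply: contrapT => nL; apply: none; exists n; exact/negP.
by have := uniq_leq_size us sL; rewrite size_map size_iota ltnn.
Qed.

(** Primitive element argument: if g fixes y + n x but moves x, then n = (y - g y) / (g x - x), and
    n is chosen outside the finitely many such ratios of conjugates. *)
Lemma primitive_generator t (s : seq F) : algK t ->
  exists y, forall g : autOver iota, g t = t -> g y = y -> fixer iota s g.
Proof.
move=> algt; elim: s => [|x s [y IH]]; first by exists 0.
have conj z : exists r : seq F, forall h : autOver iota, h t = t -> h z \in r.
  have [|r rP] := @fixer_conjugates _ _ iota [:: t] z.
    by apply: algebraic_over_sub (algt z) => v; rewrite (_ : [set` [:: t]] = [set t]) //; apply/seteqP; split=> w /=; rewrite inE => /eqP.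
  by exists r => h ht; apply: rP => v; rewrite inE => /eqP->.
have [rx rxP] := conj x; have [ry ryP] := conj y.
have [n nP] := avoid_nat [seq (y - b) / (a - x) | b <- ry, a <- rx].
exists (y + n%:R * x) => g gt; rewrite rmorphD rmorphM rmorph_nat /= => gy.
have gx : g x = x.
  apply/eqP; apply: contraNT nP => gx; apply/allpairsP; exists (g y, g x) => /=.
  split; [exact: ryP|exact: rxP|].
  have E : n%:R * (g x - x) = y - g y by rewrite mulrBr; apply/eqP; rewrite subr_eq addrAC eq_sym subr_eq -gy; apply/eqP; ring.
  by rewrite -E mulfK // subr_eq0.
move: gy; rewrite gx => /addIr gy z; rewrite inE => /orP[/eqP->//|].
exact: IH.
Qed.

Lemma fixer1 t (g : autOver iota) : fixer iota [:: t] g <-> g t = t.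
Proof. by split=> [|gt z]; [apply; rewrite inE|rewrite inE => /eqP->]. Qed.

Lemma index1_sub (U N : set (autOver iota)) : is_subgroup U -> is_subgroup N ->
  finite_set (lcosets U N) -> Defs.index U N = 1%N -> U `<=` N.
Proof.
move=> sU sN fin i1 g Ug.
have /eqP/cardfs1P[X XE] := i1.
have mem h : U h -> lcoset N h = X.
  move=> Uh; apply/eqP; rewrite -in_fset1 -XE in_fset_set // in_setE; by exists h.
have : lcoset N g = lcoset N 1%g by rewrite !mem //; exact: subgroup1.
by move=> /(lcoset_eq _ _ sN); rewrite invg1 mul1g.
Qed.

Lemma range_root (q : {poly k}) z : q != 0 -> evp z q = 0 -> range iota z.
Proof. by move=> q0 qz; apply: contrapT => zk; have := evp_neq0 zk q0; rewrite qz eqxx. Qed.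

Lemma ev2_range c z P : ev2 (iota c) z P = evp z (map_poly (horner_eval c) P).
Proof.
rewrite /eval_at2 /eval_at -map_poly_comp; congr (_.[_]); apply: eq_map_poly => p /=.
by rewrite /eval_at horner_map.
Qed.

Lemma aut_transitive t x : ~ range iota t -> ~ range iota x -> algK t ->
  exists g : autOver iota, g t = x.
Proof.
(* The trivial relation Y = 0 of the point (t, 0) makes this an instance of [minrel_conjugate]. *)
move=> tk xk algt; have [||Q Q0||g [gt _]] := @minrel_conjugate _ _ iota t 0 'X tk _ _ _ x 0 algt xk.
- exact: monicX.
- exact: ev2X.
- rewrite size_polyX ltnS => /size1_polyC E; move: Q0; rewrite E polyC_eq0 ev2C.
  exact: evp_neq0.
- exact: ev2X.
by exists g.
Qed.

(** For a the leading coefficient and n the degree of P, the polynomial a^(n-1) P(T, Y/a) is monic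
    in Y, has coefficients in k[T], and vanishes at a y. *)
Lemma monic_relation t y P : ~ range iota t -> P != 0 -> ev2 t y P = 0 ->
  exists a P1, [/\ evp t a != 0, P1 \is monic, size P1 = size P & ev2 t (evp t a * y) P1 = 0].
Proof.
move=> tk P0 Py; pose a := lead_coef P; pose n := (size P).-1.
have nP : size P = n.+1 by rewrite /n prednK // size_poly_gt0.
have n0 : (0 < n)%N.
  rewrite lt0n; apply/eqP => n0; have : (size P <= 1)%N by rewrite nP n0.
  move=> /size1_polyC E; move: P0 Py; rewrite E polyC_eq0 ev2C => c0 /eqP.
  by rewrite (negPf (evp_neq0 tk c0)).
have at0 : evp t a != 0 by apply: evp_neq0; rewrite // lead_coef_eq0.
pose Q := \poly_(i < n) (P`_i * a ^+ (n.-1 - i)).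
have sQ : (size Q < size ('X^n : {poly {poly k}}))%N by rewrite size_polyXn ltnS size_poly.
exists a, ('X^n + Q); split => //.
- by rewrite monicE lead_coefDl // lead_coefXn.
- by rewrite size_polyDl // size_polyXn.
rewrite /eval_at2 (horner_coef_wide (n := n.+1)); last first.
  by rewrite (leq_trans (size_poly _ _)) // size_polyDl // size_polyXn.
have -> : \sum_(i < n.+1) (map_poly (evp t) ('X^n + Q))`_i * (evp t a * y) ^+ i =
    evp t a ^+ n.-1 * ev2 t y P.
  rewrite /eval_at2 (horner_coef_wide (n := n.+1)); last by rewrite -nP size_poly.
  rewrite mulr_sumr !big_ord_recr /=; congr (_ + _).
    apply: eq_bigr => i _; rewrite !coef_map /= coefD coefXn coef_poly ltn_ord.
    rewrite ltn_eqF // add0r rmorphM rmorphXn /= exprMn.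
    have -> : evp t a ^+ n.-1 = evp t a ^+ (n.-1 - i) * evp t a ^+ i.
      by rewrite -exprD subnK // -ltnS prednK.
    by ring.
  rewrite !coef_map /= coefD coefXn eqxx coef_poly ltnn addr0 rmorph1 mul1r.
  have -> : evp t P`_n = evp t a by [].
  by rewrite exprMn -{1}(prednK n0) exprSr mulrA.
by rewrite Py mulr0.
Qed.

(** The resultant of P and its derivative is a nonzero polynomial in T; where it does not vanish,
    all roots of P(c0, Y) are simple. Characteristic 0 keeps the derivative nonconstant in Y. *)
Lemma simple_point t y (P : {poly {poly k}}) : ~ range iota t ->
  P \is monic -> ev2 t y P = 0 ->
  (forall Q : {poly {poly k}}, Q != 0 -> (size Q < size P)%N -> ev2 t y Q != 0) ->
  (2 < size P)%N ->
  exists c0 y0, P.[y0%:P].[c0] = 0 /\ P^`().[y0%:P].[c0] != 0.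
Proof.
move=> tk Pmon Py Pmin P2; have P0 := monic_neq0 Pmon.
pose n := (size P).-1; have nP : size P = n.+1 by rewrite /n prednK // size_poly_gt0.
have dP1 : (1 < size P^`())%N.
  rewrite ltnNge; apply/negP => le1.
  have : P^`()`_n.-1 = 0 by rewrite nth_default // (leq_trans le1) //; move: P2; rewrite nP; lia.
  rewrite coef_deriv prednK; last by move: P2; rewrite nP; lia.
  have -> : P`_n = 1 by apply/eqP; exact: Pmon.
  move/(congr1 (fun p : {poly k} => p.[0])); rewrite -polyCMn !hornerC => /eqP.
  by rewrite ((pcharf0P k).1 char0); move: P2; rewrite nP; lia.
have dPP : (size P^`() < size P)%N by rewrite lt_size_deriv.
have [c0 rc0] := closed_nonroot (minrel_resultant Pmon Py Pmin dP1 dPP).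
have [[u v] /= _ uv] := resultant_in_ideal (ltnW P2) dP1.
have sPc : size (map_poly (horner_eval c0) P) = size P.
  by rewrite size_map_poly_id0 // (monicP Pmon) rmorph1 oner_eq0.
have /closed_rootP[y0 /rootP Py0] : size (map_poly (horner_eval c0) P) != 1%N.
  by rewrite sPc gtn_eqF // ltnW.
have Pc0 : P.[y0%:P].[c0] = 0 by rewrite horner_horner hornerC.
exists c0, y0; split=> //; apply: contraNneq rc0 => dP0.
have := congr1 (fun Q : {poly {poly k}} => Q.[y0%:P].[c0]) uv.
by rewrite /= hornerC hornerD !hornerM hornerD !hornerM Pc0 dP0 !mulr0 addr0 => ->.
Qed.
End Main.

(** * Open normal subgroups and stabilisers of transcendental elements *)

Section OpenNormal.
Variables (k F : closedFieldType) (iota : {rmorphism k -> F}).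
Hypothesis char0 : [pchar k] =i pred0.
Local Notation evp := (eval_at iota).
Local Notation ev2 := (eval_at2 iota).
Local Notation algK x := (forall z, algebraic_over (adjoin iota [set x]) z).

Variable N : set (autOver iota).
Hypotheses (sN : is_subgroup N) (nN : forall g, conjset g N = N).

(** An automorphism carrying t to x conjugates one stabiliser into the other, and N is normal. *)
Lemma index_fixer1 t x : ~ range iota t -> ~ range iota x -> algK t ->
  Defs.index (fixer iota [:: x]) N = Defs.index (fixer iota [:: t]) N.
Proof.
move=> tk xk algt; have [g gt] := aut_transitive tk xk algt.
rewrite -(index_conj g (fixer iota [:: t]) N) nN; congr (Defs.index _ _).
apply/seteqP; split=> [h /fixer1 hx|_ [h /fixer1 ht <-]]; last first.
  by apply/fixer1; rewrite !autM -gt autK ht.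
exists (g^-1 * h * g)%g; last by rewrite -!mulgA mulgV mulg1 !mulgA mulgV mul1g.
by apply/fixer1; rewrite !autM gt hx -gt autK.
Qed.

Section Degrees.
Variables (t y : F) (P : {poly {poly k}}).
Hypotheses (tk : ~ range iota t) (algt : algK t).
Hypotheses (Pmon : P \is monic) (Py : ev2 t y P = 0).
Hypothesis Pmin : forall Q : {poly {poly k}},
  Q != 0 -> (size Q < size P)%N -> ev2 t y Q != 0.
Hypothesis stab : forall g : autOver iota, g t = t -> g y = y -> N g.

(** The roots of P(t, Y) are the conjugates of y under the stabiliser of t. *)
Lemma index_dvd_fixer : (Defs.index (fixer iota [:: t]) N %| (size P).-1)%N.
Proof.
have <- : size (map_poly (evp t) P) = size P.
  by rewrite size_map_poly_id0 // (monicP Pmon) rmorph1 oner_eq0.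
apply: (index_dvd_degree (x0 := y)) => //.
- exact: fixer_subgroup.
- by rewrite map_poly_eq0_id0 ?monic_neq0 // (monicP Pmon) rmorph1 oner_eq0.
- by move=> h i /fixer1 ht; rewrite coef_map /= aut_evp ht.
- exact/rootP.
- move=> y' /rootP Py'; have [g [gt gy]] := minrel_conjugate tk Pmon Py Pmin algt tk Py'.
  by exists g => //; exact/fixer1.
- by move=> h /fixer1; exact: stab.
Qed.

(* Geometrically, P(T, Y) = 0 is a plane curve with a smooth point (c0, y0), and
   s = (Y - a(T)) / (T - c0)^j where a is the branch of the curve at that point
   truncated at order j. The branch cancels the pole of s there, so s has degree
   j (d - 1), d being the degree of P in Y. *)
Section Projection.
Variables (c0 y0 : k) (a b : {poly k}) (j : nat) (s : F).
Hypotheses (ac0 : a.[c0] = y0) (simple : P^`().[y0%:P].[c0] != 0).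
Hypotheses (sa : (size a <= j)%N) (Pa : P.[a] = b * ('X - c0%:P) ^+ j).
Hypothesis Pj : forall i : nat, (size (P`_i)%R < j)%N.
Hypotheses (sk : ~ range iota s) (ys : y = evp t a + s * (t - iota c0) ^+ j).
Hypothesis P2 : (2 < size P)%N.

Let n := (size P).-1.
Let PF := map_poly (map_poly iota) P.
Let aF := map_poly iota a.
Let w : {poly F} := 'X - (iota c0)%:P.
(** Solving the formula of s for Y gives Y = A(T). Hence [G], which is P(T, A(T)), has coefficients
    in k(s) and the root t. *)
Let A := aF + s *: w ^+ j.
Let G := PF.[A].

Let nP : size P = n.+1. Proof. by rewrite /n prednK // (ltn_trans _ P2). Qed.
Let s0 : s != 0.
Proof. by apply/eqP => s0; apply: sk; exists 0; rewrite // rmorph0. Qed.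
Let wj : size (w ^+ j) = j.+1. Proof. exact: size_exp_XsubC. Qed.

Let GE x : G.[x] = ev2 x (evp x a + s * (x - iota c0) ^+ j) P.
Proof.
rewrite ev2_horner horner_horner [RHS]horner_horner hornerC; congr (_.[_]).
by rewrite /A hornerD hornerZ horner_exp hornerXsubC.
Qed.

Let sizeA : size A = j.+1.
Proof.
by rewrite /A addrC size_polyDl size_scale // wj // ltnS size_map_poly.
Qed.

Let sizeAX i : size (A ^+ i) = (j * i).+1.
Proof.
rewrite -[LHS]prednK; first by rewrite size_exp sizeA.
by rewrite size_poly_gt0 expf_neq0 // -size_poly_gt0 sizeA.
Qed.

(** By [Pj], the term A^n, of degree j n, dominates all the others. *)
Let sizeG : size G = (j * n).+1.
Proof.
have PFn : PF`_n = 1 by rewrite coef_map /= (_ : P`_n = 1) ?rmorph1 //; apply/eqP.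
rewrite /G (horner_coef_wide (n := n.+1)); last by rewrite -nP size_poly.
rewrite big_ord_recr /= PFn mul1r addrC size_polyDl sizeAX // ltnS.
apply: (leq_trans (size_sum _ _ _)); apply/bigmax_leqP => i _.
rewrite coef_map /= (leq_trans (size_polyMleq _ _)) // sizeAX size_map_poly addnS /=.
apply: (@leq_trans (j * i.+1)); last by rewrite leq_mul2l ltn_ord orbT.
by rewrite mulnS leq_add2r ltnW.
Qed.

(** The roots of f must be transcendental for [minrel_conjugate] to apply to them. A root at c0
    would express s through b(c0) and the nonzero derivative of P; a root at another c would make
    A(c) a root of P(c, Y), hence an element of k. Either way s would be in k. *)
Lemma projection_poly : exists f : {poly F},
  [/\ G = f * w ^+ j, (size f).-1 = (j * n.-1)%N & forall c, ~~ root f (iota c)].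
Proof.
have [z zE] := horner_taylor2 PF aF (s *: w ^+ j).
pose f := map_poly iota b + s *: PF^`().[aF] + s ^+ 2 *: (w ^+ j * z).
have Gf : G = f * w ^+ j.
  rewrite /G /A zE /f /PF /aF horner_map Pa rmorphM rmorphXn /= map_polyXsubC -/w.
  by rewrite -!mul_polyC !rmorphXn /=; ring.
have f0 : f != 0.
  by apply/eqP => f0; have := sizeG; rewrite Gf f0 mul0r size_poly0.
exists f; split=> // [|c].
  have := sizeG; rewrite Gf size_Mmonic ?monic_exp ?monicXsubC // wj addnS /= => sf.
  move: sf P2; rewrite nP; case: (n) => // m sf _.
  by rewrite mulnS -addnS addnC in sf; move/addnI: sf => ->.
apply/negP => /rootP fc.
have [cE|cc0] := eqVneq c c0.
  move: fc; rewrite cE /f !hornerD !hornerZ hornerM horner_exp hornerXsubC subrr.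
  rewrite expr0n gtn_eqF ?(leq_trans _ (Pj 0)) //= mul0r mulr0 addr0.
  have -> : PF^`().[aF].[iota c0] = iota (P^`().[a].[c0]).
    by rewrite /PF /aF deriv_map horner_map horner_map.
  rewrite horner_map /= => E; apply: sk; exists (- b.[c0] / P^`().[a].[c0]) => //.
  have P1a : iota P^`().[a].[c0] != 0.
    by rewrite fmorph_eq0; move: simple; rewrite !horner_horner hornerC ac0.
  rewrite fmorph_div rmorphN; apply: (mulIf P1a); rewrite divfK //.
  by apply/eqP; rewrite eq_sym -addr_eq0 addrC E.
have : G.[iota c] = 0 by rewrite Gf hornerM fc mul0r.
rewrite GE ev2_range => /range_root[].
  by rewrite map_poly_eq0_id0 ?monic_neq0 // (monicP Pmon) rmorph1 oner_eq0.
move=> v _; rewrite /eval_at horner_map -rmorphB -rmorphXn /= => vE.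
have cn : iota ((c - c0) ^+ j) != 0 by rewrite fmorph_eq0 expf_neq0 // subr_eq0.
apply: sk; exists ((v - a.[c]) / (c - c0) ^+ j) => //.
by rewrite fmorph_div rmorphB vE addrC addKr mulfK.
Qed.

(** A root x of f gives a generic point (x, A(x)) of the curve, so an automorphism carries (t, y) to
    it; being determined by these coordinates, s is fixed. Thus the stabiliser of s is transitive on
    the roots of f. *)
Lemma index_dvd_projection :
  (Defs.index (fixer iota [:: t]) N %| j * (size P).-2)%N.
Proof.
have [f [Gf sf fk]] := projection_poly.
have -> : (size P).-2 = n.-1 by [].
rewrite -sf -(index_fixer1 tk sk algt).
have f0 : f != 0 by apply: contraNneq (fk 0) => ->; rewrite root0.
have w0 : w ^+ j != 0 by rewrite expf_neq0 // polyXsubC_eq0.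
have tc : t - iota c0 != 0 by rewrite subr_eq0; apply/eqP => tE; apply: tk; exists c0.
have ft : root f t.
  apply/rootP; have := GE t; rewrite -ys Py Gf hornerM horner_exp hornerXsubC => /eqP.
  by rewrite mulf_eq0 expf_eq0 (negPf tc) andbF orbF => /eqP.
apply: (index_dvd_degree (x0 := t)) => //.
- exact: fixer_subgroup.
- move=> h i /fixer1 hs; suff hf : map_poly h f = f by rewrite -[in RHS]hf coef_map.
  have hi (p : {poly k}) : map_poly h (map_poly iota p) = map_poly iota p.
    by rewrite -map_poly_comp; apply: eq_map_poly => c /=; rewrite aut_base.
  have hw : map_poly h (w ^+ j) = w ^+ j by rewrite rmorphXn /= map_polyXsubC /= aut_base.
  have hG : map_poly h G = G.
    rewrite /G -horner_map -map_poly_comp; congr (_.[_]).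
      by apply: eq_map_poly => p /=; rewrite hi.
    by rewrite /A rmorphD /= map_polyZ /= hw hi hs.
  by apply: (mulIf w0); rewrite -{1}hw -rmorphM -Gf; exact: hG.
- move=> x fx; have xk : ~ range iota x by move=> [c _ cx]; have := fk c; rewrite cx fx.
  have Gx : ev2 x (evp x a + s * (x - iota c0) ^+ j) P = 0 by rewrite -GE Gf hornerM (rootP fx) mul0r.
  have [g [gt gy]] := minrel_conjugate tk Pmon Py Pmin algt xk Gx.
  have xc : x - iota c0 != 0 by rewrite subr_eq0; apply/eqP => xE; apply: xk; exists c0.
  exists g => //; apply/fixer1.
  have sE : s = (y - evp t a) / (t - iota c0) ^+ j.
    by rewrite ys addrC addKr mulfK // expf_neq0.
  rewrite {1}sE fmorph_div rmorphXn !rmorphB /= gy aut_evp gt aut_base.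
  by rewrite addrC addKr mulfK // expf_neq0.
- move=> h /fixer1 hs ht; apply: stab => //.
  by rewrite ys rmorphD rmorphM rmorphXn rmorphB /= aut_evp ht hs aut_base.
Qed.
End Projection.
End Degrees.

(** The degree is minimised over all suitable y at once, so that minimality survives the replacement
    of y by a y that makes P monic. *)
Lemma minimal_monic_generator t (s0 : seq F) : ~ range iota t -> algK t ->
  fixer iota s0 `<=` N ->
  exists y P, [/\ P \is monic, ev2 t y P = 0,
    (forall g : autOver iota, g t = t -> g y = y -> N g) &
    forall Q : {poly {poly k}}, Q != 0 -> (size Q < size P)%N -> ev2 t y Q != 0].
Proof.
move=> tk algt s0N.
pose good y := forall g : autOver iota, g t = t -> g y = y -> N g.
pose ex d := `[< exists y (P : {poly {poly k}}), [/\ good y, P != 0, ev2 t y P = 0 & size P = d] >].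
have exd : exists d, ex d.
  have [y yP] := primitive_generator char0 s0 algt.
  have [P P0 Py] := algebraic_relation (algt y) (fun p => evp_neq0 tk (p := p)).
  by exists (size P); apply/asboolP; exists y, P; split=> // g gt gy; exact/s0N/yP.
have [d /asboolP[y [P [gy P0 Py sP]]] dmin] := ex_minnP exd.
have [a [P1 [a0 P1mon sP1 P1y]]] := monic_relation tk P0 Py.
have gy1 : good (evp t a * y).
  move=> g gt; rewrite rmorphM /= aut_evp gt => /(mulfI a0); exact: gy.
exists (evp t a * y), P1; split=> // Q Q0; rewrite sP1 sP ltnNge; apply: contraNneq => Qy.
by apply: dmin; apply/asboolP; exists (evp t a * y), Q.
Qed.

(* The index m of N in the stabilizer of t does not depend on t; it divides d and
   j (d - 1), where j may be chosen congruent to 1 modulo d, hence m = 1. *)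
Theorem fixer1_sub_open_normal t (s0 : seq F) : ~ range iota t -> algK t ->
  fixer iota s0 `<=` N -> fixer iota [:: t] `<=` N.
Proof.
move=> tk algt s0N.
have [y [P [Pmon Py stab Pmin]]] := minimal_monic_generator tk algt s0N.
have Psize := minrel_size Pmon Py.
(* In degree 1 the element y is a polynomial in t, so it is fixed together with t. *)
have [P2|P2] := leqP (size P) 2.
  move=> g /fixer1 gt; apply: stab => //.
  have sP : size P = 2%N by apply/eqP; rewrite eqn_leq P2.
  have P1 : P`_1 = 1 by have := Pmon; rewrite monicE lead_coefE sP => /eqP.
  have yE : y = - evp t P`_0.
    apply/eqP; rewrite -addr_eq0 addrC; apply/eqP; rewrite -[RHS]Py /eval_at2.
    rewrite (horner_coef_wide (n := 2%N)); last by rewrite -sP size_poly.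
    by rewrite !big_ord_recl big_ord0 !coef_map /= P1 rmorph1 expr0 expr1 mulr1 mul1r addr0.
  by rewrite yE rmorphN /= aut_evp gt.
have [c0 [y0 [Py0 dPy0]]] := simple_point char0 tk Pmon Py Pmin P2.
(* [m] is a multiple of the degree of P, and [m.+1], the order j of the projection, exceeds the
   sizes of the coefficients of P. *)
pose e := (\max_(i < size P) size (P`_i)%R)%N.
pose m := ((size P).-1 * e.+1)%N.
have [a [sa ac0 /dvdpP[b Pa]]] := hensel_poly m Py0 dPy0.
have tc : t - iota c0 != 0 by rewrite subr_eq0; apply/eqP => tE; apply: tk; exists c0.
pose s := (y - evp t a) / (t - iota c0) ^+ m.+1.
have ys : y = evp t a + s * (t - iota c0) ^+ m.+1.
  by rewrite /s divfK ?expf_neq0 // addrC subrK.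
(* If s is constant, y is a polynomial in t and is again fixed with t; otherwise s is
   transcendental, as the projection requires. *)
have [[c _ cs]|sk] := pselect (range iota s).
  move=> g /fixer1 gt; apply: stab => //.
  by rewrite ys -cs rmorphD rmorphM rmorphXn rmorphB /= aut_evp gt !aut_base.
have Pj i : (size (P`_i)%R < m.+1)%N.
  rewrite ltnS /m; have [iP|iP] := ltnP i (size P); last first.
    by rewrite nth_default // size_poly0.
  apply: (@leq_trans e); first exact: (leq_bigmax (Ordinal iP)).
  by rewrite (leq_trans (leqnSn e)) // leq_pmull // -ltnS prednK // ltnW.
have d1 := index_dvd_fixer tk algt Pmon Py Pmin stab.
have d2 := index_dvd_projection tk algt Pmon Py Pmin stab ac0 dPy0 sa Pa Pj sk ys P2.
apply: index1_sub => //; first exact: fixer_subgroup.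
  apply: (lcosets_coarse (C := fixer iota s0)) => //; first exact: fixer_subgroup.
  apply: compact_finite_lcosets; [|exact: fixer_subgroup|exact: fixer_open].
  apply: fixer_compact => z; apply: algebraic_over_sub (algt z) => v.
  rewrite (_ : [set` [:: t]] = [set t]) //.
  by apply/seteqP; split=> x /=; rewrite inE => /eqP.
apply/eqP; rewrite -dvdn1.
have E : (size P).-1 = (size P).-2.+1 by move: P2; case: (size P) => [|[|[|]]].
have d3 : (Defs.index (fixer iota [:: t]) N %| (size P).-2)%N.
  by move: d2; rewrite /m mulSn dvdn_addl // dvdn_mulr // dvdn_mulr.
by move: d1; rewrite E -addn1 dvdn_addr.
Qed.
End OpenNormal.

(** * Reduction to transcendence degree one *)

Section Reduction.
Variables (k F : closedFieldType) (iota : {rmorphism k -> F}).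

Lemma range_divring : GRing.divring_closed [in range iota].
Proof.
split; first by apply/mem_set; exists 1; rewrite // rmorph1.
- move=> _ _ /set_mem[c _ <-] /set_mem[d _ <-]; apply/mem_set.
  by exists (c - d); rewrite // rmorphB.
- move=> _ _ /set_mem[c _ <-] /set_mem[d _ <-]; apply/mem_set.
  by exists (c / d); rewrite // fmorph_div.
Qed.

Lemma algebraic_range z : algebraic_over (range iota) z -> range iota z.
Proof.
move=> [p [p0 pK pz]]; have /choice[c cP] i : exists c, iota c = p`_i.
  by have [c _ <-] := pK i; exists c.
pose q := \poly_(i < size p) c i.
have qE : map_poly iota q = p.
  apply/polyP => i; rewrite coef_map coef_poly; case: ltnP => [_|pi]; first exact: cP.
  by rewrite nth_default //; exact: (rmorph0 iota).
apply: (@range_root _ _ _ q); last by apply/rootP; rewrite qE.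
by apply: contra_neq p0 => q0; rewrite -qE q0 rmorph0.
Qed.

Lemma indep_not_range n (t : 'I_n -> F) i : alg_independent iota t -> ~ range iota (t i).
Proof.
move=> tind [c _ tc].
have := tind (mpoly.mpolyX k (mpoly.mnm1 i) - mpoly.mpolyC n c).
rewrite mpoly.mmapB mpoly.mmapC mpoly.mmapX mpoly.mmap1U -tc subrr => /(_ erefl).
move/(congr1 (mpoly.mcoeff (mpoly.mnm1 i))).
rewrite mpoly.mcoeffB mpoly.mcoeffXU mpoly.mcoeffC mpoly.mcoeff0 eqxx.
rewrite mpoly.mnm1_eq0 mulr0 subr0 => /eqP; by rewrite oner_eq0.
Qed.

(** A shortest list over which F is algebraic replaces a transcendence basis: dropping its head u
    destroys algebraicity. It is nonempty because, for n >= 1, F contains an element transcendental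
    over k. *)
Lemma minimal_generators n : has_trdeg iota n -> (0 < n)%N ->
  exists u r, (forall x, algebraic_over (adjoin iota [set` u :: r]) x) /\
    exists x, ~ algebraic_over (adjoin iota [set` r]) x.
Proof.
move=> [t [tind talg]] n0.
pose alg (s : seq F) := forall x, algebraic_over (adjoin iota [set` s]) x.
pose ex m := `[< exists2 s, alg s & size s = m >].
have exm : exists m, ex m.
  exists (size [seq t i | i : 'I_n]); apply/asboolP; exists [seq t i | i : 'I_n] => // x.
  apply: algebraic_over_sub (talg x) => y; apply: adjoin_sub; [exact: adjoin_divring|exact: adjoin_base|].
  by move=> _ [i _ <-]; apply: adjoin_gen => /=; apply: map_f; rewrite mem_enum.
have [m /asboolP[s salg sm] mmin] := ex_minnP exm.
case: s salg sm => [|u r] salg sm.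
  exfalso; apply: (indep_not_range (i := Ordinal n0) tind); apply: algebraic_range.
  apply: algebraic_over_sub (salg _); apply: adjoin_sub; [exact: range_divring|by move=> c; exists c|].
  by move=> y /=; rewrite in_nil.
exists u, r; split=> //; apply: contrapT => none.
have : (m <= size r)%N.
  apply: mmin; apply/asboolP; exists r => // x; apply: contrapT => nx; apply: none; by exists x.
by rewrite -sm /= ltnn.
Qed.
End Reduction.

Section BaseChange.
Variables (k : fieldType) (F : closedFieldType) (iota : {rmorphism k -> F}).
Variables (r : seq F).
Let K := adjoin iota [set` r].
Let dK : GRing.divring_closed [in K] := adjoin_divring iota [set` r].
Let C := aclosure dK.
Let iotaC : {rmorphism C -> F} := aclosure_val dK.

Lemma aclosure_range x : range iotaC x <-> algebraic_over K x.
Proof.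
split=> [[c _ <-]|Kx]; first exact: (subfield_valP (c : subfield (alg_closure_divring dK))).
by exists (Sub x (mem_set Kx) : subfield (alg_closure_divring dK)).
Qed.

Fact incl_base (g : autOver iotaC) c : g (iota c) = iota c.
Proof.
have [d _ <-] : range iotaC (iota c) by apply/aclosure_range/algebraic_over_id => //; exact: adjoin_base.
exact: aut_base.
Qed.

Definition incl (g : autOver iotaC) : autOver iota :=
  @AutOver _ _ iota g (aut_inv g) (aut_zmod g) (aut_monoid g) (aut_funK g) (aut_invK g) (incl_base g).

Lemma inclM g h : incl (g * h)%g = (incl g * incl h)%g.
Proof. exact: autP. Qed.

Lemma incl_fixer g : fixer iota r (incl g).
Proof.
move=> x xr; have [d _ <-] : range iotaC x.
  by apply/aclosure_range/algebraic_over_id => //; exact: adjoin_gen.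
exact: (aut_base g).
Qed.

Lemma aclosure_pchar : [pchar k] =i pred0 -> [pchar C] =i pred0.
Proof.
move=> k0; apply/pcharf0P => n.
by rewrite -(fmorph_eq0 iotaC) rmorph_nat -(rmorph_nat iota) fmorph_eq0 ((pcharf0P k).1 k0).
Qed.

Lemma aclosure_transcendental u :
  (forall x, algebraic_over (adjoin iota [set` u :: r]) x) ->
  (exists x, ~ algebraic_over K x) -> ~ range iotaC u.
Proof.
move=> alg [x nx] /aclosure_range uK; apply: nx; apply: (alg_closure_trans dK).
apply: algebraic_over_sub (alg x); apply: adjoin_sub.
- exact: alg_closure_divring.
- by move=> c; apply: algebraic_over_id => //; exact: adjoin_base.
move=> y /=; rewrite inE => /orP[/eqP->//|yr].
by apply: algebraic_over_id => //; exact: adjoin_gen.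
Qed.

Lemma aclosure_algebraic u :
  (forall x, algebraic_over (adjoin iota [set` u :: r]) x) ->
  forall x, algebraic_over (adjoin iotaC [set u]) x.
Proof.
move=> alg x; apply: algebraic_over_sub (alg x); apply: adjoin_sub.
- exact: adjoin_divring.
- move=> c; have [d _ <-] : range iotaC (iota c).
    by apply/aclosure_range/algebraic_over_id => //; exact: adjoin_base.
  exact: adjoin_base.
move=> y /=; rewrite inE => /orP[/eqP->|yr]; first exact: adjoin_gen.
have [d _ <-] : range iotaC y by apply/aclosure_range/algebraic_over_id => //; exact: adjoin_gen.
exact: adjoin_base.
Qed.
End BaseChange.

(** * The automorphisms u -> u^p and their action on Q(chi) *)

Section PowerMaps.
Variables (k F : closedFieldType) (iota : {rmorphism k -> F}).
Hypothesis char0 : [pchar k] =i pred0.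
Variables (u : F) (r : seq F).
Hypothesis alg : forall x, algebraic_over (adjoin iota [set` u :: r]) x.
Hypothesis nalg : exists x, ~ algebraic_over (adjoin iota [set` r]) x.

Let C := aclosure (adjoin_divring iota [set` r]).
Let iotaC : {rmorphism C -> F} := aclosure_val (adjoin_divring iota [set` r]).
Let uC : ~ range iotaC u := aclosure_transcendental alg nalg.
Let algC : forall x, algebraic_over (adjoin iotaC [set u]) x := aclosure_algebraic alg.

Lemma power_transcendental p : (0 < p)%N -> ~ range iotaC (u ^+ p).
Proof.
move=> p0 [c _ cE]; apply: uC; apply: (@range_root _ _ _ ('X^p - c%:P)).
  by rewrite -size_poly_gt0 size_XnsubC.
by rewrite rmorphB rmorphXn /= evpX evpC cE subrr.
Qed.

Lemma power_map p : (0 < p)%N -> exists g : autOver iotaC, g u = u ^+ p.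
Proof. by move=> p0; apply: aut_transitive => //; exact: power_transcendental. Qed.

(** The cosets correspond to the p-th roots of unity z through u -> u z. There are p of them in
    characteristic 0; they lie in C, so u z is transcendental over C and some automorphism over C
    realises it. *)
Lemma index_power p : (0 < p)%N ->
  Defs.index (fixer iota (u ^+ p :: r)) (fixer iota (u :: r)) = p.
Proof.
move=> p0; have Fp : p%:R != 0 :> F by rewrite (natr_fieldF iota char0) -lt0n.
have [zs zsE] := closed_field_poly_normal ('X^p - 1 : {poly F}).
have mon : ('X^p - 1 : {poly F}) \is monic by rewrite monicXnsubC.
rewrite (monicP mon) scale1r in zsE.
have uzs : uniq zs by rewrite -separable_prod_XsubC -zsE separable_Xn_sub_1.
have szs : size zs = p.
  by apply: succn_inj; rewrite -(size_prod_XsubC zs id) -zsE size_XnsubC.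
have zsP z : (z \in zs) = (z ^+ p == 1).
  by rewrite -root_prod_XsubC -zsE rootE !hornerE subr_eq0.
have /choice[h hP] z : exists g : autOver iotaC, z \in zs -> g u = u * z.
  have [zz|nz] := boolP (z \in zs); last by exists 1%g.
  have [c cz] : range iotaC z.
    apply: (@range_root _ _ _ ('X^p - 1)).
      by rewrite -size_poly_gt0 size_XnsubC.
    by rewrite rmorphB rmorphXn /= evpX rmorph1; apply/eqP; rewrite subr_eq0 -zsP.
  move=> cE; have z0 : z != 0.
    by apply: contraTneq zz => ->; rewrite zsP expr0n gtn_eqF // eq_sym oner_eq0.
  have [g gE] : exists g : autOver iotaC, g u = u * z.
    apply: aut_transitive => // -[d _ dE]; apply: uC; exists (d / c) => //.
    by rewrite fmorph_div dE cE mulfK.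
  by exists g.
have hU z : z \in zs -> fixer iota (u ^+ p :: r) (incl (h z)).
  move=> zz x; rewrite inE => /orP[/eqP->|]; last exact: incl_fixer.
  rewrite rmorphXn /= hP // exprMn; move: zz; rewrite zsP => /eqP ->.
  by rewrite mulr1.
have u0 : u != 0 by apply/eqP => u0; apply: uC; exists 0; rewrite // rmorph0 u0.
have sV := fixer_subgroup iota (u :: r).
have fixV (g : autOver iota) : fixer iota r g -> g u = u -> fixer iota (u :: r) g.
  by move=> gr gu x; rewrite inE => /orP[/eqP->|/gr].
have fixU (g : autOver iota) : fixer iota (u ^+ p :: r) g -> fixer iota r g.
  by move=> gU x xr; apply: gU; rewrite inE xr orbT.
rewrite -{2}szs -(size_map (fun z => lcoset (fixer iota (u :: r)) (incl (h z))) zs).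
apply: card_fset_set_seq.
  rewrite map_inj_in_uniq // => z z' zz zz' /(lcoset_eq _ _ sV) /(_ u).
  rewrite inE eqxx => /(_ isT); rewrite autM => E.
  have : incl (h z) u = incl (h z') u by rewrite -[in RHS]E autKV.
  by rewrite /= !hP // => /(mulfI u0).
move=> X; split=> [[g gU <-]|/mapP[z zz ->]]; last by exists (incl (h z)); [exact: hU|].
have gup : (g u / u) ^+ p = 1.
  rewrite expr_div_n -rmorphXn /= gU ?inE ?eqxx // divff // expf_neq0 //.
pose z := g u / u; have zz : z \in zs by rewrite zsP gup.
apply/mapP; exists z => //; apply/lcoset_eq => //.
have hg : incl (h z) u = g u by rewrite /= hP // mulrC divfK.
apply: fixV; last by rewrite autM -hg autK.
apply: (subgroupM (fixer_subgroup iota r)); last exact: fixU.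
by apply: (subgroupV (fixer_subgroup iota r)); exact: incl_fixer.
Qed.

Let U0 : cosubgroup (autOver iota) := fixer_cos alg.

(** As g fixes r, conjugation by it carries the stabiliser of u and r to that of u^p and r, which
    contains the former with index p. *)
Lemma chi_power_map p (g : autOver iotaC) x : prime p -> g u = u ^+ p ->
  chi_module (autOver iota) (incl g) x = p%:R *: x.
Proof.
move=> pp gu; have p0 := prime_gt0 pp.
have cE : conjcos (incl g) U0 = fixer iota (u ^+ p :: r) :> set _.
  apply/seteqP; split=> [_ [h hU <-] y|h hU].
    rewrite inE => /orP[/eqP->|yr].
      by rewrite !autM -gu [X in h X](autK (incl g) u) hU ?inE ?eqxx.
    have gy : incl g y = y by exact: incl_fixer.
    by rewrite !autM -{1}gy autK hU ?inE ?yr ?orbT.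
  exists ((incl g)^-1 * h * incl g)%g; last by rewrite -!mulgA mulgV mulg1 !mulgA mulgV mul1g.
  move=> y; rewrite inE !autM => /orP[/eqP->|yr].
    by rewrite /= gu hU ?inE ?eqxx // -gu; exact: (autK (incl g) u).
  have gy : incl g y = y by exact: incl_fixer.
  by rewrite gy hU ?inE ?yr ?orbT // -{1}gy autK.
have UE : (U0 : set _) = fixer iota (u :: r) by [].
rewrite (@chi_act_index _ U0).
  by rewrite cE UE index_power.
rewrite cE UE => h hU y; rewrite inE => /orP[/eqP->|yr].
  by rewrite rmorphXn /= hU // inE eqxx.
by apply: hU; rewrite inE yr orbT.
Qed.
End PowerMaps.

Theorem corollary3p24 (k F : closedFieldType) (iota : {rmorphism k -> F})
    (n : nat) (kchar0 : [pchar k] =i pred0) (n_ge1 : (1 <= n)%N)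
    (trdegF : has_trdeg iota n)
    (W : lmodType rat) (rho : gmodule (autOver iota) W)
    (Wfin : fin_dim [set: W]%classic) (Wpol : polarizable rho) :
  forall w : W, w = 0.
Proof.
have [u [r [alg nalg]]] := minimal_generators trdegF n_ge1.
set dK := adjoin_divring iota [set` r].
pose iotaC : {rmorphism aclosure dK -> F} := aclosure_val dK.
have uC : ~ range iotaC u := aclosure_transcendental alg nalg.
have algC : forall x, algebraic_over (adjoin iotaC [set u]) x := aclosure_algebraic alg.
have [[smooth_rho _] [B [Bsym Bequi Bpos]]] := Wpol.
have [s sker] := smooth_kernel smooth_rho Wfin.
(* The kernel is pulled back to Aut(F/C), over which F has a single transcendental generator. *)
pose N : set (autOver iotaC) := [set g | forall w, rho (incl g) w = w].
have incl1 : incl (1%g : autOver iotaC) = 1%g by exact: autP.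
have rhoV (g : autOver iotaC) w : rho (incl g^-1%g) (rho (incl g) w) = w.
  by rewrite -gactM -inclM mulVg incl1 gact1.
have rhoV' (g : autOver iotaC) w : rho (incl g) (rho (incl g^-1%g) w) = w.
  by rewrite -gactM -inclM mulgV incl1 gact1.
have sN : is_subgroup N.
  split; first by apply/mem_set => w; rewrite incl1 gact1.
  move=> g h /set_mem gN /set_mem hN; apply/mem_set => w.
  by rewrite inclM gactM -[in LHS](hN w) rhoV gN.
have nN0 g : conjset g N `<=` N.
  by move=> _ [h hN <-] w; rewrite !inclM !gactM hN rhoV'.
have nN g : conjset g N = N.
  apply/seteqP; split=> [|h hN]; first exact: nN0.
  exists (g^-1 * h * g)%g; last by rewrite -!mulgA mulgV mulg1 !mulgA mulgV mul1g.
  by rewrite -[X in (_ * X)%g]invgK; apply: nN0; exists h.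
have fixN : fixer iotaC [:: u] `<=` N.
  have C0 : [pchar aclosure dK] =i pred0 := aclosure_pchar iota r kchar0.
  apply: (@fixer1_sub_open_normal _ _ iotaC C0 N sN nN u s uC algC).
  by move=> g gs w; apply: sker.
have /choice[sg sgP] p : exists g : autOver iotaC, (0 < p)%N -> g u = u ^+ p.
  have [p0|p0] := posnP p; first by exists 1%g; rewrite p0.
  by have [g gE] := power_map alg nalg p0; exists g.
(* Another choice of [U0] would only rescale the rational form [b] by a positive factor. *)
have [U0 _] : exists U : cosubgroup (autOver iota), True by exists (fixer_cos alg).
pose b v w : rat := haar_chi U0 (B v w).
apply: (@no_similitude_family W b _ _ _ (fun p => rho (incl (sg p)))) => //.
- by move=> v w; rewrite /b Bsym.
- by move=> w a v v'; rewrite /b linearPl linearP.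
- by move=> w w0; exact/haar_chi_gt0/Bpos.
- move=> p q w pp pq.
  have [p0 q0] := (prime_gt0 pp, prime_gt0 pq).
  rewrite -!gactM -!inclM.
  have : N ((sg q * sg p)^-1 * (sg p * sg q))%g.
    apply/fixN/fixer1; rewrite autM.
    have -> : (sg p * sg q)%g u = (sg q * sg p)%g u.
      by rewrite !autM !sgP // !rmorphXn /= !sgP // -!exprM mulnC.
    by rewrite autK.
  move=> /(_ w) E; rewrite -[in RHS]E -gactM -inclM; congr (rho (incl _) w).
  by rewrite mulgA mulgV mul1g.
- move=> p v w pp; rewrite /b Bequi (chi_power_map kchar0 alg nalg _ pp (sgP p (prime_gt0 pp))).
  by rewrite linearZ.
Qed.
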